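(* Let $\xi\in\mathbb{R}$ be such that $1,\xi,\xi^3$ are linearly independent over $\mathbb{Q}$, let $\lambda,c>0$ be such that for each sufficiently large real number $X$ there exists a non-zero point $\mathbf{x}\in\mathbb{Z}^3$ with $\|\mathbf{x}\|\le X$ and $L(\mathbf{x})\le cX^{-\lambda}$, and let $(\mathbf{x}_i)_{i\ge1}$ be a sequence of minimal points for $(1,\xi,\xi^3)$. Suppose that $\lambda>\lambda_0:=(1+3\sqrt5)/11\cong0.7007$. Then there exist a positive integer $d$ and a polynomial $P\in\mathcal{P}_d$ such that $P(\mathbf{x}_i,\mathbf{x}_j)=0$ for infinitely many pairs of consecutive elements $i<j$ in $I$.
   Context: For $\mathbf{x}=(x_0,x_1,x_2)\in\mathbb{R}^3$, put $\|\mathbf{x}\|=\max\{|x_0|,|x_1|,|x_2|\}$ and $L(\mathbf{x})=\max\{|x_1-x_0\xi|,|x_2-x_0\xi^3|\}$. A sequence of minimal points for $(1,\xi,\xi^3)$ is a sequence $(\mathbf{x}_i)_{i\ge1}$ of non-zero points of $\mathbb{Z}^3$ such that, with $X_i=\|\mathbf{x}_i\|$ and $L_i=L(\mathbf{x}_i)$: (a) $X_1<X_2<X_3<\cdots$; (b) $1/2>L_1>L_2>L_3>\cdots$; (c) if $L(\mathbf{x})<L_i$ for some $\mathbf{x}\in\mathbb{Z}^3\setminus\{0\}$ and some $i\ge1$, then $\|\mathbf{x}\|\ge X_{i+1}$. $I$ is the set of integers $i\ge2$ such that $\mathbf{x}_{i-1},\mathbf{x}_i,\mathbf{x}_{i+1}$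 are linearly independent; it is an infinite set, ordered increasingly. Here $\mathbb{N}$ contains $0$. For triples of indeterminates $\mathbf{x},\mathbf{y},\mathbf{z}$ put $\varphi(\mathbf{x})=x_0^2x_2-x_1^3$ and $\Phi(\mathbf{x},\mathbf{y},\mathbf{z})=x_0y_0z_2+x_0y_2z_0+x_2y_0z_0-3x_1y_1z_1$, and $$S=\varphi(\mathbf{x}),\quad T=\Phi(\mathbf{x},\mathbf{x},\mathbf{y}),\quad U=\Phi(\mathbf{x},\mathbf{y},\mathbf{y}),\quad V=\varphi(\mathbf{y}),\quad F=T^2-4SU .$$ For $\ell\in\mathbb{N}$, let $\mathcal{R}_\ell$ be the set of elements of $\mathbb{Q}[S,T,U,V]\subset\mathbb{Q}[\mathbf{x},\mathbf{y}]$ which are bihomogeneous of bidegree $(2\ell,\ell)$ in $(\mathbf{x},\mathbf{y})$ (together with $0$). For $k\in\mathbb{N}$, let $J^{(k)}$ be the ideal of $\mathbb{Q}[\mathbf{x},\mathbf{y}]$ generated by the bihomogeneous polynomials $P(\mathbf{x},\mathbf{y})$ such that $q^k$ divides $P(\mathbf{x},\mathbf{x}+q\mathbf{y})$ in $\mathbb{Q}[q,\mathbf{x},\mathbf{y}]$, where $q$ is a new indeterminate. The $J$-valuation of a non-zero bihomogeneous $P$ is the largest $k$ such that $q^k$ divides $P(\mathbf{x},\mathbf{x}+q\mathbf{y})$, equivalently the largest $k$ with $P\in J^{(k)}$. For $d\in\mathbb{N}$ let $\mathcal{T}_d=\{(m,n)\in\mathbb{N}^2:\ 2m+3n\le d\}$.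 For each non-empty subset $E$ of $\mathcal{T}_d$, one fixes a choice of a non-zero polynomial $P_E\in\mathcal{R}_d$ of the form $$P_E=\sum_{(m,n)\in E}a_{m,n}T^{d-2m-3n}F^m(S^2V)^n\qquad(a_{m,n}\in\mathbb{Q})$$ whose $J$-valuation is maximal among all non-zero polynomials of this form. $\mathcal{P}_d$ denotes the finite set of all polynomials $P_E$, as $E$ runs through the non-empty subsets of $\mathcal{T}_d$. *)

(* Defs.v *)
From HB Require Import structures.
From mathcomp Require Import all_boot all_order all_algebra.
From mathcomp Require Import reals.
From mathcomp Require Import mpoly.

Set Implicit Arguments.
Unset Strict Implicit.
Unset Printing Implicit Defensive.

Import Order.TTheory GRing.Theory Num.Theory.
Local Open Scope ring_scope.

Section Points.
Variables (R : realType) (xi : R).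

Definition lin_indep_Q_1_xi_xi3 : Prop :=
  forall a b c : rat, ratr a + ratr b * xi + ratr c * xi ^+ 3 = 0 :> R ->
    [/\ a = 0, b = 0 & c = 0].

Definition c0 : 'I_3 := @Ordinal 3 0 isT.
Definition c1 : 'I_3 := @Ordinal 3 1 isT.
Definition c2 : 'I_3 := @Ordinal 3 2 isT.

Definition toR (x : 'rV[int]_3) : 'rV[R]_3 := map_mx intr x.

Definition supnorm (x : 'rV[R]_3) : R :=
  Num.max (Num.max `|x 0 c0| `|x 0 c1|) `|x 0 c2|.

Definition Ldist (x : 'rV[R]_3) : R :=
  Num.max `|x 0 c1 - x 0 c0 * xi| `|x 0 c2 - x 0 c0 * xi ^+ 3|.

(* The sequence is indexed by i >= 1; the value x 0 is unconstrained. *)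
Definition minimal_points (x : nat -> 'rV[int]_3) : Prop :=
  let X i := supnorm (toR (x i)) in
  let L i := Ldist (toR (x i)) in
  [/\ forall i, (1 <= i)%N -> x i != 0,
      forall i, (1 <= i)%N -> X i < X i.+1,
      L 1%N < 1 / 2 /\ (forall i, (1 <= i)%N -> L i.+1 < L i)
    & forall (y : 'rV[int]_3) i, (1 <= i)%N -> y != 0 ->
        Ldist (toR y) < L i -> X i.+1 <= supnorm (toR y)].

Definition indexI (x : nat -> 'rV[int]_3) (i : nat) : Prop :=
  (2 <= i)%N /\ free [:: toR (x i.-1); toR (x i); toR (x i.+1)].

End Points.

Definition consecutive (A : nat -> Prop) (i j : nat) : Prop :=
  [/\ A i, A j, (i < j)%N & forall k, A k -> ~~ ((i < k) && (k < j))%N].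

(* Q[x, y]: variables 0, 1, 2 are x0, x1, x2 and 3, 4, 5 are y0, y1, y2. *)
Definition Qxy := {mpoly rat[3 + 3]}.

Definition xvar (k : 'I_3) : Qxy := 'X_(lshift 3 k).
Definition yvar (k : 'I_3) : Qxy := 'X_(rshift 3 k).

Definition phi (A : comNzRingType) (x : 'I_3 -> A) : A :=
  x c0 ^+ 2 * x c2 - x c1 ^+ 3.

Definition Phi (A : comNzRingType) (x y z : 'I_3 -> A) : A :=
  x c0 * y c0 * z c2 + x c0 * y c2 * z c0 + x c2 * y c0 * z c0
  - 3%:R * x c1 * y c1 * z c1.

Definition polS : Qxy := phi xvar.
Definition polT : Qxy := Phi xvar xvar yvar.
Definition polU : Qxy := Phi xvar yvar yvar.
Definition polV : Qxy := phi yvar.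
Definition polF : Qxy := polT ^+ 2 - 4%:R * polS * polU.

(* Holds for P = 0 at every bidegree. *)
Definition bihomogeneous (a b : nat) (P : Qxy) : Prop :=
  forall m, m \in msupp P ->
    (\sum_(k < 3) m (lshift 3 k) = a)%N /\ (\sum_(k < 3) m (rshift 3 k) = b)%N.

Definition in_R (l : nat) (P : Qxy) : Prop :=
  (exists G : {mpoly rat[4]}, P = G \mPo [tuple polS; polT; polU; polV])
  /\ bihomogeneous (2 * l) l P.

(* P(x, x + q y) in Q[q, x, y], viewed as (Q[x, y])[q] with q = 'X. *)
Definition subst_xqy (P : Qxy) : {poly Qxy} :=
  mmap (polyC \o @mpolyC (3 + 3) rat)
       (fun i => match split i with
                 | inl k => (xvar k)%:P
                 | inr k => (xvar k)%:P + 'X * (yvar k)%:P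
                 end) P.

Definition qdiv (k : nat) (P : Qxy) : Prop :=
  exists W : {poly Qxy}, subst_xqy P = 'X^k * W.

Definition J_valuation (P : Qxy) (k : nat) : Prop :=
  qdiv k P /\ (forall j, qdiv j P -> (j <= k)%N).

(* 2 m + 3 n <= d forces m, n <= d, so bounding both indices by d loses
   nothing. *)
Definition Tset (d : nat) : {set 'I_d.+1 * 'I_d.+1} :=
  [set p : 'I_d.+1 * 'I_d.+1 | (2 * p.1 + 3 * p.2 <= d)%N].

Definition has_form (d : nat) (E : {set 'I_d.+1 * 'I_d.+1}) (P : Qxy) : Prop :=
  in_R d P /\
  exists a : 'I_d.+1 -> 'I_d.+1 -> rat,
    P = \sum_(p in E) a p.1 p.2 *:
          (polT ^+ (d - 2 * p.1 - 3 * p.2) * polF ^+ p.1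
           * (polS ^+ 2 * polV) ^+ p.2).

Definition maximal_choice (d : nat) (E : {set 'I_d.+1 * 'I_d.+1}) (P : Qxy) :
    Prop :=
  [/\ P != 0, has_form E P
    & exists2 v, J_valuation P v
      & forall (W : Qxy) (k : nat), W != 0 -> has_form E W ->
          J_valuation W k -> (k <= v)%N].

Definition poly_family := forall d : nat, {set 'I_d.+1 * 'I_d.+1} -> Qxy.

(* PE d E is the fixed P_E; its values for E empty or E not inside Tset d are
   irrelevant. *)
Definition is_choice_of_P (PE : poly_family) : Prop :=
  forall d (E : {set 'I_d.+1 * 'I_d.+1}),
    E != set0 -> E \subset Tset d -> maximal_choice E (PE d E).

Definition in_calP (PE : poly_family) (d : nat) (P : Qxy) : Prop :=
  exists E : {set 'I_d.+1 * 'I_d.+1},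
    [/\ E != set0, E \subset Tset d & P = PE d E].

Definition eval_int (P : Qxy) (x y : 'rV[int]_3) : rat :=
  P.@[fun i => (row_mx x y 0 i)%:~R].

(* Main.v *)
Require Import Defs.
From HB Require Import structures.
From mathcomp Require Import all_boot all_order all_algebra.
From mathcomp Require Import classical_sets cardinality reals exp.
From mathcomp Require Import ring lra zify.
From mathcomp Require mpoly.
(** Write X_i for the norm and L_i for the distance of the i-th minimal point, and
let i < j be consecutive in I.  A value P(x_i, x_j) with P in R_d is small for
an analytic reason and divisible by a large power of an integer for an
arithmetic one; if the first effect beats the second, the value is 0.

Arithmetic.  Two consecutive minimal points form a basis of the integer points
of the plane that they span, so x_j = a x_i + b x_{i+1} with integers a, b, and
minimality yields |b| >= X_j / (3 X_{i+1}) ([coef_bound]).  If q^k divides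
P(x, x + q y), then P(x_i, x_j) is b^k times an integer, up to a denominator
depending on P alone ([ev_divisible]).  For P = P_E the exponent k is bounded
below by counting.  The forms A = 3 F + T^2 and
B = 108 S^2 V - 4 T^3 + 3 T A acquire the factors q^2 and q^3 under
y := x + q y, and every T^w F^m (S^2 V)^n of weight d = w + 2m + 3n is a
combination of T^{d-2m'-3n'} A^{m'} B^{n'}.  Valuation at least k is therefore
implied by the vanishing of at most #{(m',n') : 2m' + 3n' < k} linear forms in
the coefficients.  If E has more elements than that, some non-zero polynomial
supported on E has valuation at least k, hence so has P_E ([qdiv_choice]).

Analysis.  Points close to (1, xi, xi^3) make T, F and S^2 V small:
T << X_i X_j L_i, S^2 V << X_i^4 X_j^2 L_i^2 L_j, and
F << X_i^3 X_j L_i L_j + X_j^2 L_i^4, the last one after a cancellation in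
T^2 - 4 S U.  Given a pair, take for E the monomials of weight d whose upper
bound is at most X_j^{C d}.  In the triangle T_d this removes a corner at T^d,
so E is counted by areas, and the value is 0 as soon as C d is smaller than
k times the logarithm of X_j / X_{i+1} to the base X_j.  Optimising C turns
this requirement into g^2 + (T - f)(T - v) > T^2, where T, f, v are the costs
of T, F, S^2 V per unit of weight and g is the gain ([degree_choice]).

Constraints.  Three facts restrict the exponents: L_i << X_{i+1}^{-lambda};
X_j << X_{i+1} L_i X_{j+1} L_j, because the planes before and after x_j meet in
the line of x_j ([height_inequality]); and 1 << X_i^2 L_i, because phi does not
vanish at x_i for large i ([phi_neq0]).  Put u = log X_{i+1} / log X_j.  Since u stays in
[0, 1], it is infinitely often at most epsilon below its value at the previous
pair, and at such pairs everything is controlled by u and lambda.  If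
2 lambda u >= 1, already F is too small to be non-zero.  Otherwise the
quadratic inequality holds on the whole admissible range of u; at the left end
of the range it reads 11 lambda^2 - 2 lambda - 4 > 0, that is
lambda > (1 + 3 sqrt 5) / 11 ([quadratic_gap]).  All strict inequalities have
room to spare, so multiplicative constants are absorbed by lowering lambda a
little, and d depends on lambda only ([pair_forces_vanishing]).  There are
finitely many E for this d, so one P_E vanishes at infinitely many pairs. *)

Set Implicit Arguments.
Unset Strict Implicit.
Unset Printing Implicit Defensive.
Import Order.TTheory GRing.Theory Num.Theory.
Local Open Scope ring_scope.

(** * The covariants T, F, S^2 V and their behaviour under y := x + q y *)

Section Covariants.
Import mpoly.

Section Forms.
Variable A : comNzRingType.
Implicit Types x y : 'I_3 -> A.

Definition formT x y := Phi x x y.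
Definition formF x y := formT x y ^+ 2 - 4%:R * phi x * Phi x y y.
(** The form S^2 V, which has bidegree (6, 3) and so the same ratio of degrees
    as T and F. *)
Definition formW x y := phi x ^+ 2 * phi y.

Lemma phi_shift x y q :
  phi (fun k => x k + q * y k)
  = phi x + q * formT x y + q ^+ 2 * Phi x y y + q ^+ 3 * phi y.
Proof. rewrite /formT /phi /Phi; ring. Qed.

Lemma formT_shift x y q :
  formT x (fun k => x k + q * y k) = 3 * phi x + q * formT x y.
Proof. rewrite /formT /phi /Phi; ring. Qed.

Lemma PhiU_shift x y q (z := fun k => x k + q * y k) :
  Phi x z z = 3 * phi x + 2 * q * formT x y + q ^+ 2 * Phi x y y.
Proof. rewrite /z /formT /phi /Phi; ring. Qed.

(** [formA] and [formB] are coordinates centred at the point (T, F, S^2 V) =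
    (3, -3, 1) reached, for S = 1, when y = x; they vanish there to the orders 2
    and 3 in q. *)
Definition formA x y := 3 * formF x y + formT x y ^+ 2.
Definition formB x y :=
  108 * formW x y - 4 * formT x y ^+ 3 + 3 * formT x y * formA x y.

(** For y := x + q y one has T := 3S + qT, U := 3S + 2qT + q^2 U, so the terms
    of order 0 and 1 in q cancel in 3F + T^2. *)
Lemma formA_shift x y q :
  formA x (fun k => x k + q * y k) = q ^+ 2 * formA x y.
Proof.
rewrite /formA /formF formT_shift PhiU_shift.
set S := phi x; set T := formT x y; set U := Phi x y y; ring.
Qed.

(** The coefficients 108, -4, 3 are those for which the terms of order at most
    2 in q cancel. *)
Lemma formB_shift x y q :
  formB x (fun k => x k + q * y k) = q ^+ 3 * formB x y.
Proof.
rewrite /formB formA_shift /formW phi_shift formT_shift.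
rewrite /formA /formF.
set S := phi x; set T := formT x y; set U := Phi x y y; set V := phi y; ring.
Qed.
End Forms.

Section Morph.
Variables (A B : comNzRingType) (f : {rmorphism A -> B}).
Lemma rmorph_phi x : f (phi x) = phi (f \o x).
Proof. by rewrite /phi rmorphB rmorphM !rmorphXn. Qed.
Lemma rmorph_Phi x y z : f (Phi x y z) = Phi (f \o x) (f \o y) (f \o z).
Proof. by rewrite /Phi rmorphB !rmorphD !rmorphM rmorph_nat. Qed.
Lemma rmorph_formT x y : f (formT x y) = formT (f \o x) (f \o y).
Proof. exact: rmorph_Phi. Qed.
Lemma rmorph_formF x y : f (formF x y) = formF (f \o x) (f \o y).
Proof.
rewrite /formF rmorphB rmorphXn !rmorphM.
by rewrite rmorph_formT rmorph_phi rmorph_Phi rmorph_nat.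
Qed.
Lemma rmorph_formW x y : f (formW x y) = formW (f \o x) (f \o y).
Proof. by rewrite /formW rmorphM rmorphXn !rmorph_phi. Qed.
Lemma rmorph_formA x y : f (formA x y) = formA (f \o x) (f \o y).
Proof.
by rewrite /formA rmorphD rmorphM rmorphXn rmorph_formF rmorph_formT rmorph_nat.
Qed.
Lemma rmorph_formB x y : f (formB x y) = formB (f \o x) (f \o y).
Proof.
rewrite /formB rmorphD rmorphB; congr (_ - _ + _).
- by rewrite rmorphM rmorph_formW rmorph_nat.
- by rewrite rmorphM rmorphXn rmorph_formT rmorph_nat.
- by rewrite !rmorphM rmorph_formT rmorph_formA rmorph_nat.
Qed.
End Morph.

Lemma bihom0 a b : bihomogeneous a b 0.
Proof. by move=> m; rewrite msupp0. Qed.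

Lemma bihomD a b P Q :
  bihomogeneous a b P -> bihomogeneous a b Q -> bihomogeneous a b (P + Q).
Proof.
move=> hP hQ m /msuppD_le; rewrite mem_cat => /orP[/hP|/hQ]; exact.
Qed.

Lemma bihomZ a b c P : bihomogeneous a b P -> bihomogeneous a b (c *: P).
Proof. by move=> hP m /msuppZ_le /hP. Qed.

Lemma bihomN a b P : bihomogeneous a b P -> bihomogeneous a b (- P).
Proof. by rewrite -scaleN1r; apply: bihomZ. Qed.

Lemma bihomM a b a' b' P Q : bihomogeneous a b P -> bihomogeneous a' b' Q ->
  bihomogeneous (a + a') (b + b') (P * Q).
Proof.
move=> hP hQ m /msuppM_le /allpairsP[[m1 m2] /= [/hP[h1 h2] /hQ[h3 h4] ->]].
rewrite -h1 -h2 -h3 -h4 -!big_split /=.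
by split; apply: eq_bigr => k _; rewrite mnmDE.
Qed.

Lemma bihom1 : bihomogeneous 0 0 1.
Proof.
by move=> m; rewrite msupp1 inE => /eqP ->; rewrite !big1 // => k _; rewrite mnm0E.
Qed.

Lemma bihomXn a b n P :
  bihomogeneous a b P -> bihomogeneous (n * a) (n * b) (P ^+ n).
Proof.
move=> hP; elim: n => [|n IH]; first exact: bihom1.
by rewrite exprS !mulSn; apply: bihomM.
Qed.

Lemma bihom_sum a b (I : Type) (r : seq I) (p : pred I) (F : I -> Qxy) :
  (forall i, p i -> bihomogeneous a b (F i)) ->
  bihomogeneous a b (\sum_(i <- r | p i) F i).
Proof.
move=> hF; apply: (big_ind (bihomogeneous a b)) => //; first exact: bihom0.
exact: bihomD.
Qed.

Lemma bihom_nat n : bihomogeneous 0 0 n%:R.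
Proof.
elim: n => [|n IH]; first exact: bihom0.
by rewrite mulrS; apply: bihomD => //; exact: bihom1.
Qed.

Lemma bihom_xvar k : bihomogeneous 1 0 (xvar k).
Proof.
move=> m; rewrite /xvar msuppX inE => /eqP ->; split.
  rewrite (bigD1 k) //= mnm1E eqxx big1 // => i hi.
  by rewrite mnm1E eq_lshift eq_sym (negPf hi).
by rewrite big1 // => i _; rewrite mnm1E eq_lrshift.
Qed.

Lemma bihom_yvar k : bihomogeneous 0 1 (yvar k).
Proof.
move=> m; rewrite /yvar msuppX inE => /eqP ->; split; last first.
  rewrite (bigD1 k) //= mnm1E eqxx big1 // => i hi.
  by rewrite mnm1E eq_rshift eq_sym (negPf hi).
by rewrite big1 // => i _; rewrite mnm1E eq_rlshift.
Qed.

Lemma bihom_phi a b v : (forall k, bihomogeneous a b (v k)) ->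
  bihomogeneous (3 * a) (3 * b) (phi v).
Proof.
move=> h; apply: bihomD; last by apply: bihomN; apply: bihomXn.
rewrite -[3%N]/(2 + 1)%N !mulnDl !mul1n.
by apply: bihomM => //; apply: bihomXn.
Qed.

Lemma bihom_Phi a1 b1 a2 b2 a3 b3 u v w :
  (forall k, bihomogeneous a1 b1 (u k)) -> (forall k, bihomogeneous a2 b2 (v k)) ->
  (forall k, bihomogeneous a3 b3 (w k)) ->
  bihomogeneous (a1 + a2 + a3) (b1 + b2 + b3) (Phi u v w).
Proof.
move=> h1 h2 h3.
apply: bihomD; last first.
  apply: bihomN.
  rewrite -[a1]add0n -[b1]add0n; do 3!apply: bihomM => //; exact: bihom_nat.
by do !apply: bihomD; do !apply: bihomM.
Qed.

Lemma polF_E : polF = formF xvar yvar. Proof. by []. Qed.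
Lemma polT_E : polT = formT xvar yvar. Proof. by []. Qed.

Lemma bihom_polS : bihomogeneous 3 0 polS.
Proof. exact: (bihom_phi bihom_xvar). Qed.
Lemma bihom_polV : bihomogeneous 0 3 polV.
Proof. exact: (bihom_phi bihom_yvar). Qed.
Lemma bihom_polT : bihomogeneous 2 1 polT.
Proof. exact: (bihom_Phi bihom_xvar bihom_xvar bihom_yvar). Qed.
Lemma bihom_polU : bihomogeneous 1 2 polU.
Proof. exact: (bihom_Phi bihom_xvar bihom_yvar bihom_yvar). Qed.
Lemma bihom_polF : bihomogeneous 4 2 polF.
Proof.
apply: bihomD; first exact: (bihomXn (n := 2) bihom_polT).
apply: bihomN; rewrite -[4%N]/(0 + 3 + 1)%N -[2%N]/(0 + 0 + 2)%N.
apply: bihomM bihom_polU; apply: bihomM bihom_polS; exact: bihom_nat.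
Qed.
Lemma bihom_polW : bihomogeneous 6 3 (polS ^+ 2 * polV).
Proof. exact: (bihomM (bihomXn (n := 2) bihom_polS) bihom_polV). Qed.

Definition monTFW d (m n : nat) : Qxy :=
  polT ^+ (d - 2 * m - 3 * n) * polF ^+ m * (polS ^+ 2 * polV) ^+ n.

Lemma bihom_mon d m n : (2 * m + 3 * n <= d)%N ->
  bihomogeneous (2 * d) d (monTFW d m n).
Proof.
move=> le_d.
have -> : (2 * d = (d - 2 * m - 3 * n) * 2 + m * 4 + n * 6)%N by lia.
have {2}-> : (d = (d - 2 * m - 3 * n) * 1 + m * 2 + n * 3)%N by lia.
apply: bihomM; last exact: (bihomXn bihom_polW).
by apply: bihomM; [exact: (bihomXn bihom_polT)|exact: (bihomXn bihom_polF)].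
Qed.

Definition inSTUV (P : Qxy) :=
  exists G : {mpoly rat[4]}, P = G \mPo [tuple polS; polT; polU; polV].

Lemma inSTUV_D P Q : inSTUV P -> inSTUV Q -> inSTUV (P + Q).
Proof. by case=> G -> [H ->]; exists (G + H); rewrite comp_mpolyD. Qed.
Lemma inSTUV_M P Q : inSTUV P -> inSTUV Q -> inSTUV (P * Q).
Proof. by case=> G -> [H ->]; exists (G * H); rewrite rmorphM. Qed.
Lemma inSTUV_Z c P : inSTUV P -> inSTUV (c *: P).
Proof. by case=> G ->; exists (c *: G); rewrite comp_mpolyZ. Qed.
Lemma inSTUV_1 : inSTUV 1.
Proof. by exists 1; rewrite comp_mpoly1. Qed.
Lemma inSTUV_0 : inSTUV 0.
Proof. by exists 0; rewrite comp_mpoly0. Qed.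
Lemma inSTUV_X n P : inSTUV P -> inSTUV (P ^+ n).
Proof.
by move=> h; elim: n => [|n IH]; [exact: inSTUV_1|rewrite exprS; apply: inSTUV_M].
Qed.
Lemma inSTUV_gen (i : 'I_4) : inSTUV [:: polS; polT; polU; polV]`_i.
Proof. by exists 'X_i; rewrite comp_mpolyXU. Qed.
Lemma inSTUV_S : inSTUV polS. Proof. exact: (inSTUV_gen (@Ordinal 4 0 isT)). Qed.
Lemma inSTUV_T : inSTUV polT. Proof. exact: (inSTUV_gen (@Ordinal 4 1 isT)). Qed.
Lemma inSTUV_U : inSTUV polU. Proof. exact: (inSTUV_gen (@Ordinal 4 2 isT)). Qed.
Lemma inSTUV_V : inSTUV polV. Proof. exact: (inSTUV_gen (@Ordinal 4 3 isT)). Qed.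
Lemma inSTUV_F : inSTUV polF.
Proof.
rewrite /polF -mulrA [4%:R * _]mulr_natl -scaler_nat -scaleNr.
apply: inSTUV_D; first exact: (inSTUV_X _ inSTUV_T).
by apply: inSTUV_Z; apply: inSTUV_M; [exact: inSTUV_S|exact: inSTUV_U].
Qed.

Lemma has_form_sum d (E : {set 'I_d.+1 * 'I_d.+1}) a : E \subset Tset d ->
  has_form E (\sum_(p in E) a p.1 p.2 *: monTFW d p.1 p.2).
Proof.
move=> sE; split; last by exists a.
split.
  apply: (big_ind inSTUV); [exact: inSTUV_0|exact: inSTUV_D|] => p _.
  apply: inSTUV_Z; apply: inSTUV_M; last first.
    by apply/inSTUV_X/inSTUV_M; [exact/inSTUV_X/inSTUV_S|exact: inSTUV_V].
  by apply: inSTUV_M; apply: inSTUV_X; [exact: inSTUV_T|exact: inSTUV_F].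
apply: bihom_sum => p /(fintype.subsetP sE); rewrite inE => hp.
exact/bihomZ/bihom_mon.
Qed.
End Covariants.

(** * Expansion of T^w F^m (S^2 V)^n along q-adically small generators *)

Section Expansion.
Import mpoly.

Definition subst_morph : {rmorphism Qxy -> {poly Qxy}} :=
  mmap (polyC \o @mpolyC (3 + 3) rat : {rmorphism rat -> {poly Qxy}})
       (fun i => match split i with
                 | inl k => (xvar k)%:P
                 | inr k => (xvar k)%:P + 'X * (yvar k)%:P
                 end).
Lemma subst_morphE P : subst_xqy P = subst_morph P. Proof. by []. Qed.

Lemma subst_x k : subst_morph (xvar k) = (xvar k)%:P.
Proof. by rewrite /subst_morph /= mmapX mmap1U (unsplitK (inl k)). Qed.
Lemma subst_y k : subst_morph (yvar k) = (xvar k)%:P + 'X * (yvar k)%:P.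
Proof. by rewrite /subst_morph /= mmapX mmap1U (unsplitK (inr k)). Qed.

Definition polA := formA xvar yvar.
Definition polB := formB xvar yvar.

Lemma eq_formA (A : comNzRingType) (x y x' y' : 'I_3 -> A) :
  x =1 x' -> y =1 y' -> formA x y = formA x' y'.
Proof. by move=> hx hy; rewrite /formA /formF /formT /phi /Phi !hx !hy. Qed.

Lemma eq_formB (A : comNzRingType) (x y x' y' : 'I_3 -> A) :
  x =1 x' -> y =1 y' -> formB x y = formB x' y'.
Proof.
move=> hx hy; rewrite /formB (eq_formA hx hy) /formW /formT /phi /Phi.
by rewrite !hx !hy.
Qed.

Lemma subst_A : subst_morph polA = 'X ^+ 2 * polA%:P.
Proof.
rewrite /polA rmorph_formA (rmorph_formA polyC) -formA_shift.
by apply: eq_formA => k; rewrite /comp; [exact: subst_x|exact: subst_y].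
Qed.

Lemma subst_B : subst_morph polB = 'X ^+ 3 * polB%:P.
Proof.
rewrite /polB rmorph_formB (rmorph_formB polyC) -formB_shift.
by apply: eq_formB => k; rewrite /comp; [exact: subst_x|exact: subst_y].
Qed.

Lemma qdiv0 k : qdiv k 0.
Proof. by exists 0; rewrite subst_morphE rmorph0 mulr0. Qed.
Lemma qdivD k P Q : qdiv k P -> qdiv k Q -> qdiv k (P + Q).
Proof.
move=> [U hU] [V hV]; exists (U + V); move: hU hV; rewrite !subst_morphE.
by rewrite rmorphD mulrDr => -> ->.
Qed.
Lemma qdivMl k P Q : qdiv k Q -> qdiv k (P * Q).
Proof.
move=> [U hU]; exists (subst_morph P * U); move: hU; rewrite !subst_morphE rmorphM => ->.
by rewrite mulrCA.
Qed.
Lemma qdivZ k c P : qdiv k P -> qdiv k (c *: P).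
Proof. by rewrite -mul_mpolyC; apply: qdivMl. Qed.
Lemma qdivW j k P : (j <= k)%N -> qdiv k P -> qdiv j P.
Proof.
move=> jk [W hW]; exists ('X ^+ (k - j) * W).
by rewrite hW mulrA -exprD subnKC.
Qed.

Definition monTAB d (t : nat * nat) : Qxy :=
  polT ^+ (d - 2 * t.1 - 3 * t.2) * polA ^+ t.1 * polB ^+ t.2.

Lemma exp_weight23 (A : comNzRingType) (q a b : A) m n :
  (q ^+ 2 * a) ^+ m * (q ^+ 3 * b) ^+ n = q ^+ (2 * m + 3 * n) * (a ^+ m * b ^+ n).
Proof. by rewrite (exprMn _ (q ^+ 2)) (exprMn _ (q ^+ 3)) exprD !exprM mulrACA. Qed.

Lemma qdiv_monTAB d k t : (k <= 2 * t.1 + 3 * t.2)%N -> qdiv k (monTAB d t).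
Proof.
move=> kt; apply: (qdivW kt); rewrite /monTAB -mulrA; apply: qdivMl.
exists (polA%:P ^+ t.1 * polB%:P ^+ t.2).
rewrite subst_morphE rmorphM (rmorphXn subst_morph t.1) (rmorphXn subst_morph t.2).
rewrite subst_A subst_B; exact: exp_weight23.
Qed.

(** Combinations of the T^w A^m B^n of weight d, as lists of pairs of a
    coefficient and an exponent (m, n), so that products by T, A and B act by a
    mere relabelling. *)
Definition inspan d (P : Qxy) :=
  exists s : seq (rat * (nat * nat)),
    all (fun t => 2 * t.2.1 + 3 * t.2.2 <= d)%N s
    /\ P = \sum_(t <- s) t.1 *: monTAB d t.2.

Lemma inspan_D d P Q : inspan d P -> inspan d Q -> inspan d (P + Q).
Proof.
move=> [s [hs ->]] [t [ht ->]]; exists (s ++ t).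
by rewrite all_cat hs ht big_cat.
Qed.

Lemma inspan_map d d' (g : rat -> rat) (h : nat * nat -> nat * nat) (Q P : Qxy) :
  (forall t, (2 * t.1 + 3 * t.2 <= d)%N ->
     (2 * (h t).1 + 3 * (h t).2 <= d')%N /\
     forall c, Q * (c *: monTAB d t) = g c *: monTAB d' (h t)) ->
  inspan d P -> inspan d' (Q * P).
Proof.
move=> H [s [hs ->]]; exists [seq (g t.1, h t.2) | t <- s]; split.
  by rewrite all_map; apply: sub_all hs => t /H[].
rewrite big_map mulr_sumr !big_seq; apply: eq_bigr => t /(allP hs) /H[_].
exact.
Qed.

Lemma inspan_Z d c P : inspan d P -> inspan d (c *: P).
Proof.
rewrite -mul_mpolyC; apply: (inspan_map (g := *%R c) (h := id)) => t ht.
by split=> // c'; rewrite mul_mpolyC scalerA.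
Qed.

Lemma inspan_T d P : inspan d P -> inspan d.+1 (polT * P).
Proof.
apply: (inspan_map (g := id) (h := id)) => t ht; split=> [|c]; first by lia.
rewrite -scalerAr /monTAB !mulrA -exprS.
by have -> : ((d - 2 * t.1 - 3 * t.2).+1 = d.+1 - 2 * t.1 - 3 * t.2)%N by lia.
Qed.

Lemma inspan_A d P : inspan d P -> inspan d.+2 (polA * P).
Proof.
apply: (inspan_map (g := id) (h := fun t => (t.1.+1, t.2))) => t ht /=.
split=> [|c]; first by lia.
rewrite -scalerAr /monTAB /= exprS.
have -> : (d.+2 - 2 * t.1.+1 - 3 * t.2 = d - 2 * t.1 - 3 * t.2)%N by lia.
by congr (_ *: _); ring.
Qed.

Lemma inspan_B d P : inspan d P -> inspan d.+3 (polB * P).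
Proof.
apply: (inspan_map (g := id) (h := fun t => (t.1, t.2.+1))) => t ht /=.
split=> [|c]; first by lia.
rewrite -scalerAr /monTAB /= exprS.
have -> : (d.+3 - 2 * t.1 - 3 * t.2.+1 = d - 2 * t.1 - 3 * t.2)%N by lia.
by congr (_ *: _); ring.
Qed.

Lemma polF_AE : polF = 3^-1 *: (polA - polT * polT).
Proof.
have -> : polA = 3 *: polF + polT * polT.
  by rewrite /polA /formA -polF_E -polT_E scaler_nat mulr_natl expr2.
by rewrite addrK scalerA mulVf // scale1r.
Qed.

Lemma polW_AE : polS ^+ 2 * polV =
  108^-1 *: (polB + 4 *: (polT * (polT * polT)) - 3 *: (polT * polA)).
Proof.
have -> : polB = 108 *: (polS ^+ 2 * polV) - 4 *: (polT * (polT * polT))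
                 + 3 *: (polT * polA).
  rewrite [polB]/(108%:R * (polS ^+ 2 * polV) - 4%:R * polT ^+ 3 + 3%:R * polT * polA).
  rewrite !scaler_nat -mulrA !(mulr_natl _ _) (exprS polT 2) (expr2 polT). by [].
rewrite (addrAC (_ - _)) subrK addrK.
by rewrite scalerA mulVf // scale1r.
Qed.

Lemma inspan_F d P : inspan d P -> inspan d.+2 (polF * P).
Proof.
move=> hP; rewrite polF_AE -scalerAl; apply: inspan_Z.
rewrite mulrBl; apply: inspan_D; first exact: inspan_A.
by rewrite -scaleN1r -mulrA; apply: inspan_Z; do 2!apply: inspan_T.
Qed.

Lemma inspan_W d P : inspan d P -> inspan d.+3 (polS ^+ 2 * polV * P).
Proof.
move=> hP; rewrite polW_AE -scalerAl; apply: inspan_Z.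
rewrite mulrBl mulrDl -!scalerAl -scaleNr -!mulrA.
apply: inspan_D; last by apply: inspan_Z; apply: inspan_T; apply: inspan_A.
apply: inspan_D; first exact: inspan_B.
by apply: inspan_Z; do 3!apply: inspan_T.
Qed.

Lemma inspan_TFW w m n :
  inspan (w + 2 * m + 3 * n)
    (polT ^+ w * polF ^+ m * (polS ^+ 2 * polV) ^+ n).
Proof.
elim: n => [|n IH].
  elim: m => [|m IH].
    elim: w => [|w IH].
      exists [:: (1, (0, 0)%N)] => /=; split=> //.
      by rewrite big_seq1 /monTAB /= !expr0 !mulr1 scale1r.
    rewrite exprS -2!mulrA addSn addSn; apply: inspan_T; rewrite mulrA; exact: IH.
  rewrite (exprS _ m) mulrCA -mulrA.
  have -> : (w + 2 * m.+1 + 3 * 0 = (w + 2 * m + 3 * 0).+2)%N by lia.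
  by apply: inspan_F.
rewrite (exprS _ n) mulrCA.
have -> : (w + 2 * m + 3 * n.+1 = (w + 2 * m + 3 * n).+3)%N by lia.
exact: inspan_W.
Qed.

(** F and S^2 V are polynomials in T, A, B, homogeneous for the weights 1, 2, 3. *)
Lemma inspan_mon d m n : (2 * m + 3 * n <= d)%N -> inspan d (monTFW d m n).
Proof.
move=> h; have := inspan_TFW (d - 2 * m - 3 * n) m n.
by have -> : (d - 2 * m - 3 * n + 2 * m + 3 * n = d)%N by lia.
Qed.

(** Collecting equal exponents turns a list into a family of coefficients
    indexed by T_d. *)
Lemma inspan_Tset d P : inspan d P ->
  exists c : 'I_d.+1 * 'I_d.+1 -> rat,
    P = \sum_(q in Tset d) c q *: monTAB d (q.1 : nat, q.2 : nat).
Proof.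
move=> [s [hs ->]].
pose i (t : rat * (nat * nat)) : 'I_d.+1 * 'I_d.+1 := (inord t.2.1, inord t.2.2).
exists (fun q => \sum_(t <- s | i t == q) t.1).
rewrite big_seq (partition_big i (mem (Tset d))) /=; last first.
  move=> t /(allP hs) ht; rewrite inE /= !inordK; lia.
apply: eq_bigr => q _; rewrite scaler_suml -big_seq_cond /=.
rewrite big_seq_cond [RHS]big_seq_cond; apply: eq_bigr => t /andP[/(allP hs) ht /eqP <-] /=.
rewrite !inordK; first by case: t {ht} => ? [].
all: lia.
Qed.
End Expansion.

(** * Linear independence of the monomials T^w F^m (S^2 V)^n *)

Section Evaluation.
Import mpoly.

Definition xy_fun (S : Type) (u v : 'I_3 -> S) (i : 'I_(3 + 3)) : S :=
  match split i with inl k => u k | inr k => v k end.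

Lemma xy_fun_l S (u v : 'I_3 -> S) k : xy_fun u v (lshift 3 k) = u k.
Proof. by rewrite /xy_fun (unsplitK (inl k)). Qed.
Lemma xy_fun_r S (u v : 'I_3 -> S) k : xy_fun u v (rshift 3 k) = v k.
Proof. by rewrite /xy_fun (unsplitK (inr k)). Qed.

Section Eval.
Variables (S : comNzRingType) (f : {rmorphism rat -> S}) (u v : 'I_3 -> S).
Definition ev : {rmorphism Qxy -> S} := mmap f (xy_fun u v).
Lemma evC c : ev c%:MP = f c. Proof. by rewrite /ev /= mmapC. Qed.
Lemma evZ c P : ev (c *: P) = f c * ev P. Proof. by rewrite /ev /= mmapZ. Qed.
Lemma ev_x k : ev (xvar k) = u k.
Proof. by rewrite /ev /= mmapX mmap1U xy_fun_l. Qed.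
Lemma ev_y k : ev (yvar k) = v k.
Proof. by rewrite /ev /= mmapX mmap1U xy_fun_r. Qed.
Lemma ev_T : ev polT = formT u v.
Proof. by rewrite [LHS]rmorph_formT /formT /Phi /comp !ev_x !ev_y. Qed.
Lemma ev_F : ev polF = formF u v.
Proof. by rewrite [LHS]rmorph_formF /formF /formT /phi /Phi /comp !ev_x !ev_y. Qed.
Lemma ev_W : ev (polS ^+ 2 * polV) = formW u v.
Proof. by rewrite [LHS]rmorph_formW /formW /phi /comp !ev_x !ev_y. Qed.

Lemma ev_mon d m n : ev (monTFW d m n) =
  formT u v ^+ (d - 2 * m - 3 * n) * formF u v ^+ m * formW u v ^+ n.
Proof.
rewrite /monTFW rmorphM rmorphM (rmorphXn ev (d - 2 * m - 3 * n)).
by rewrite (rmorphXn ev m) (rmorphXn ev n) ev_T ev_F ev_W.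
Qed.
End Eval.

(** A ring morphism on Q[x, y] is determined by its values on constants and
    variables. *)
Lemma ev_ext (S : comNzRingType) (g : {rmorphism Qxy -> S})
    (f : {rmorphism rat -> S}) u v :
  (forall c, g c%:MP = f c) -> (forall k, g (xvar k) = u k) ->
  (forall k, g (yvar k) = v k) -> g =1 ev f u v.
Proof.
move=> hc hx hy P; rewrite [P]mpolyE !raddf_sum /=; apply: eq_bigr => m _.
rewrite -mul_mpolyC !rmorphM hc -/(ev f u v _) evC; congr (_ * _).
rewrite mpolyXE_id !rmorph_prod; apply: eq_bigr => i _.
rewrite !rmorphXn; congr (_ ^+ _); rewrite -/(ev f u v _).
case: (splitP i) => k hk.
  by have -> : i = lshift 3 k by [exact: val_inj]; rewrite ev_x -hx.
by have -> : i = rshift 3 k by [exact: val_inj]; rewrite ev_y -hy.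
Qed.

(** Specialise x = (1, 0, 1) and y = (s, r, 1 - 2s): then S = T = 1, while
    F = (1 - 2s)(1 - 6s) depends on s alone and S^2 V = s^2 (1 - 2s) - r^3 has
    positive degree in r over Q[s]. *)
Lemma mon_independent d (E : {set 'I_d.+1 * 'I_d.+1})
    (a : 'I_d.+1 -> 'I_d.+1 -> rat) :
  \sum_(p in E) a p.1 p.2 *: monTFW d p.1 p.2 = 0 ->
  forall p, p \in E -> a p.1 p.2 = 0.
Proof.
pose f2 : {rmorphism rat -> {poly {poly rat}}} := polyC \o polyC.
pose u (k : 'I_3) : {poly {poly rat}} := nth 0 [:: 1; 0; 1] k.
pose v (k : 'I_3) : {poly {poly rat}} :=
  nth 0 [:: 'X%:P; 'X; 1 - 2%:R * 'X%:P] k.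
(* The inner variable is s and the outer one is r. *)
pose f : {poly rat} := (1 - 2%:R * 'X) * (1 - 6%:R * 'X).
pose w : {poly {poly rat}} := ('X ^+ 2 * (1 - 2%:R * 'X))%:P - 'X^3.
have hT : formT u v = 1 by rewrite /formT /Phi /u /v /=; ring.
have hF : formF u v = f%:P.
  rewrite /formF /formT /phi /Phi /u /v /f /=.
  rewrite !rmorphM !rmorphB !rmorphM !rmorph1 !rmorph_nat; ring.
have hW : formW u v = w.
  rewrite /formW /phi /u /v /w /=.
  rewrite !rmorphM !rmorphB !rmorphM !rmorph1 !rmorph_nat; ring.
move=> h0.
have : ev f2 u v (\sum_(p in E) a p.1 p.2 *: monTFW d p.1 p.2) = 0.
  by rewrite h0 rmorph0.
rewrite raddf_sum /=.
under eq_bigr => p _ do rewrite -/(ev f2 u v _) evZ ev_mon hT expr1n mul1r hF hW.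
(* The relation reads q (w) = 0 with q a polynomial over Q[s]; composition with
   a polynomial of positive degree is injective. *)
pose q : {poly {poly rat}} :=
  \sum_(p in E) ((a p.1 p.2)%:P * f ^+ p.1) *: 'X^(p.2).
move=> hq; have /eqP : q \Po w = 0.
  rewrite -hq /q raddf_sum /=; apply: eq_bigr => p _.
  rewrite comp_polyZ comp_Xn_poly -mul_polyC rmorphM rmorphXn /=.
  by rewrite mulrA.
have sw : (1 < size w)%N.
  rewrite /w addrC size_polyDl size_polyN size_polyXn //.
  by apply: leq_ltn_trans (size_polyC_leq1 _) _.
have sf : (1 < size f)%N.
  have -> : f = 12%:R *: 'X^2 + (1 - 8 *: 'X).
    by rewrite /f -!mul_polyC !rmorph_nat; ring.
  have s2 : size (12%:R *: 'X^2 : {poly rat}) = 3%N.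
    by rewrite size_scale ?size_polyXn.
  rewrite size_polyDl s2 //.
  rewrite (leq_ltn_trans (size_polyD _ _)) // size_polyN size_poly1.
  by rewrite size_scale ?size_polyX.
rewrite comp_poly_eq0 // => /eqP q0 p0 hp0.
pose r : {poly rat} := \sum_(p in E | p.2 == p0.2) a p.1 p.2 *: 'X^(p.1).
have /eqP : r \Po f = 0.
  have := congr1 (fun g : {poly {poly rat}} => g`_(p0.2)) q0.
  rewrite coef0 /q coef_sum => <-; rewrite /r raddf_sum /= big_mkcondr /=.
  apply: eq_bigr => p _; rewrite coefZ coefXn.
  have -> : (p0.2 == p.2 :> nat) = (p.2 == p0.2) by rewrite eq_sym.
  case: eqP => _; last by rewrite mulr0.
  by rewrite comp_polyZ comp_Xn_poly mulr1 mul_polyC.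
rewrite comp_poly_eq0 // => /eqP r0.
have := congr1 (fun g : {poly rat} => g`_(p0.1)) r0.
rewrite coef0 /r coef_sum (bigD1 p0) /=; last by rewrite hp0 eqxx.
rewrite coefZ coefXn eqxx mulr1 big1 ?addr0 // => p /andP[/andP[_ /eqP h2] hne].
rewrite coefZ coefXn; case: eqP => [h1|]; last by rewrite mulr0.
case/eqP: hne; case: p h2 h1 => p1 p2 /= -> /val_inj <-.
by case: (p0).
Qed.
End Evaluation.

(** * Lower bound for the J-valuation of the chosen polynomials *)

Section Valuation.
Import mpoly.

(** The exponents (m, n) for which T^{d-2m-3n} A^m B^n is not divisible by q^k
    after the substitution. *)
Definition lowset d k : {set 'I_d.+1 * 'I_d.+1} :=
  [set p in Tset d | (2 * p.1 + 3 * p.2 < k)%N].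

(** The coefficients on E live in a space of dimension #E, and it is enough to
    kill the coordinates of the polynomial at the exponents of [lowset d k]. *)
Lemma exists_high_valuation d k (E : {set 'I_d.+1 * 'I_d.+1}) :
  E \subset Tset d -> (#|lowset d k| < #|E|)%N ->
  exists W, [/\ W != 0, has_form E W & qdiv k W].
Proof.
move=> sE ltE.
have ex_c (p : 'I_d.+1 * 'I_d.+1) : exists c : {ffun 'I_d.+1 * 'I_d.+1 -> rat},
    p \in Tset d ->
    monTFW d p.1 p.2 = \sum_(q in Tset d) c q *: monTAB d (q.1 : nat, q.2 : nat).
  have [hp|] := boolP (p \in Tset d); last by exists [ffun=> 0].
  have /inspan_Tset[c hc] : inspan d (monTFW d p.1 p.2).
    by apply: inspan_mon; move: hp; rewrite inE.
  by exists (finfun c) => _; rewrite hc; apply: eq_bigr => q _; rewrite ffunE.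
have [c hc] := fin_all_exists ex_c.
pose Mx : 'M[rat]_(#|E|, #|lowset d k|) :=
  \matrix_(i, j) c (enum_val i) (enum_val j).
have : kermx Mx != 0.
  rewrite -mxrank_eq0 mxrank_ker -lt0n subn_gt0.
  exact: leq_ltn_trans (rank_leq_col _) ltE.
case/rowV0Pn => r /sub_kermxP rM r0.
have [i0 hi0] : exists i, r 0 i != 0.
  apply/existsP; apply: contraNT r0; rewrite negb_exists => /forallP h.
  by apply/eqP/rowP => i; rewrite mxE; apply/eqP; move: (h i); rewrite negbK.
have p0E := enum_valP i0.
pose ap p := r 0 (enum_rank_in p0E p).
pose a (m n : 'I_d.+1) := ap (m, n).
exists (\sum_(p in E) a p.1 p.2 *: monTFW d p.1 p.2); split.
- apply/negP => /eqP /mon_independent /(_ _ p0E) h; move/eqP: hi0; apply.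
  by move: h; rewrite /a /ap -surjective_pairing enum_valK_in.
- exact: has_form_sum.
have -> : \sum_(p in E) a p.1 p.2 *: monTFW d p.1 p.2 =
    \sum_(q in Tset d) (\sum_(p in E) ap p * c p q) *: monTAB d (q.1 : nat, q.2 : nat).
  under [RHS]eq_bigr do rewrite scaler_suml.
  rewrite exchange_big /=; apply: eq_bigr => p hp.
  rewrite (hc p); last exact: (fintype.subsetP sE).
  rewrite scaler_sumr; apply: eq_bigr => q _.
  by rewrite scalerA /a -surjective_pairing.
apply: (big_ind (qdiv k)); [exact: qdiv0|exact: qdivD|] => q hq.
have [ltk|] := ltnP (2 * q.1 + 3 * q.2) k; last first.
  by move=> h; apply: qdivZ; apply: qdiv_monTAB.
have ql : q \in lowset d k by rewrite inE hq ltk.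
rewrite [X in X *: _](_ : _ = 0) ?scale0r; first exact: qdiv0.
have := congr1 (fun A : 'M[rat]_(1, _) => A 0 (enum_rank_in ql q)) rM.
rewrite !mxE => h; rewrite -[RHS]h (big_enum_val (fun p => ap p * c p q)) /=.
by apply: eq_bigr => i _; rewrite /ap mxE !enum_valK_in enum_rankK_in.
Qed.

(** Setting q = 1 and then y := y - x recovers P, so the substitution is
    injective. *)
Lemma subst_neq0 P : P != 0 -> subst_morph P != 0.
Proof.
apply: contraNneq => h.
(* setting q = 1 and then y := y - x recovers P *)
pose g : {rmorphism Qxy -> Qxy} :=
  ev (@mpolyC (3 + 3) rat) xvar (fun k => yvar k - xvar k).
pose h1 : {rmorphism Qxy -> Qxy} := g \o (horner_eval 1 \o subst_morph).
have hE : h1 =1 ev (@mpolyC (3 + 3) rat) xvar yvar.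
  apply: ev_ext => [c|k|k]; rewrite /h1 /=.
  - rewrite /horner_eval /subst_morph /= mmapC /= hornerC; exact: evC.
  - rewrite -/(subst_morph _) subst_x /horner_eval hornerC; exact: ev_x.
  - rewrite -/(subst_morph _) subst_y /horner_eval !hornerE.
    rewrite -/(g _) rmorphD /g ev_x ev_y; ring.
have hid : (idfun : {rmorphism Qxy -> Qxy}) =1 ev (@mpolyC (3 + 3) rat) xvar yvar.
  by apply: ev_ext.
by rewrite -[P]/(idfun P) hid -hE /h1 /= -/(subst_morph _) h !rmorph0.
Qed.

Lemma J_valuation_exists P : P != 0 -> exists v, J_valuation P v.
Proof.
move=> /subst_neq0 P0.
pose Q k := boolp.asbool (qdiv k P).
have ex0 : exists k, Q k.
  by exists 0%N; apply/boolp.asboolP; exists (subst_xqy P); rewrite expr0 mul1r.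
have bnd k : Q k -> (k <= size (subst_morph P))%N.
  move=> /boolp.asboolP [W hW]; move: P0; rewrite -subst_morphE hW => h.
  have W0 : W != 0 by apply: contraNneq h => ->; rewrite mulr0.
  by rewrite mulrC size_mulXn // leq_addr.
case: (ex_maxnP ex0 bnd) => v /boolp.asboolP hv hmax.
by exists v; split=> // j hj; apply: hmax; apply/boolp.asboolP.
Qed.

(** Maximality compares P_E with the polynomial of [exists_high_valuation]. *)
Lemma qdiv_choice (PE : poly_family) d (E : {set 'I_d.+1 * 'I_d.+1}) k :
  is_choice_of_P PE -> E != finset.set0 -> E \subset Tset d ->
  (#|lowset d k| < #|E|)%N -> qdiv k (PE d E).
Proof.
move=> hPE E0 sE ltE.
have [W [W0 hW qW]] := exists_high_valuation sE ltE.
have [w hw] := J_valuation_exists W0.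
have [_ _ [v [qv _] hmax]] := hPE d E E0 sE.
apply: qdivW qv; apply: leq_trans (hmax _ _ W0 hW hw).
by case: hw => _; apply.
Qed.
End Valuation.

(** * The J-valuation forces divisibility of integer values *)

Section Divisibility.
Import mpoly.

Section Line.
Variables (x z : 'I_3 -> int) (a : int).
Let xq k : {poly rat} := (x k)%:~R%:P.
Let zq k : {poly rat} := (z k)%:~R%:P.

(** The polynomial P(x, a x + t z) in t. *)
Definition line : {rmorphism Qxy -> {poly rat}} :=
  ev polyC xq (fun k => a%:~R%:P * xq k + 'X * zq k).

Lemma line_at (b : int) P (y := fun k => a * x k + b * z k) :
  (line P).[b%:~R] =
  ev idfun (fun k => (x k)%:~R) (fun k => (y k)%:~R : rat) P.
Proof.
pose g : {rmorphism Qxy -> rat} := horner_eval b%:~R \o line.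
have -> : (line P).[b%:~R] = g P by [].
move: P; apply: ev_ext => [c|k|k]; rewrite /g /= /horner_eval -/(line _) /line.
- by rewrite evC hornerC.
- by rewrite ev_x hornerC.
- by rewrite ev_y /xq /zq !hornerE rmorphD !rmorphM.
Qed.

End Line.

Lemma mpoly_clear_denom (P : Qxy) : exists2 N, (0 < N)%N &
  forall m, (N%:R * P@_m) \is a Num.int.
Proof.
exists (\prod_(m <- msupp P) `|denq P@_m|)%N.
  by rewrite prodn_gt0 // => m; rewrite absz_gt0 denq_eq0.
move=> m; have [hm|/memN_msupp_eq0 ->] := boolP (m \in msupp P); last first.
  by rewrite mulr0 rpred0.
rewrite (big_rem m hm) /= natrM mulrAC.
rewrite rpredM ?rpred_nat // natr_absz normr_denq mulrC -numqE.
exact: Num.Theory.intr_int.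
Qed.

Definition int_poly (q : {poly rat}) := exists p : {poly int}, q = map_poly intr p.

Lemma int_polyM p q : int_poly p -> int_poly q -> int_poly (p * q).
Proof. by move=> [p' ->] [q' ->]; exists (p' * q'); rewrite rmorphM. Qed.

Lemma int_polyC (n : int) : int_poly n%:~R%:P.
Proof. by exists n%:P; rewrite map_polyC. Qed.

(** The denominator is uniform in x, z and a.  Clearing it coefficient by
    coefficient, and not only in the value, keeps integrality after division by
    a power of t. *)
Lemma line_clear_denom (P : Qxy) : exists2 N, (0 < N)%N &
  forall x z a i, (N%:R * (line x z a P)`_i) \is a Num.int.
Proof.
have [N N0 hN] := mpoly_clear_denom P; exists N => // x z a i.
have -> : N%:R * (line x z a P)`_i = (N%:R *: line x z a P)`_i by rewrite coefZ.
suff [p ->] : int_poly (N%:R *: line x z a P).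
  by rewrite coef_map; exact: Num.Theory.intr_int.
rewrite /line /ev /= /mmap scaler_sumr.
apply: (big_ind int_poly) => [||m _]; first by exists 0; rewrite rmorph0.
  by move=> _ _ [p ->] [q ->]; exists (p + q); rewrite rmorphD.
rewrite -mul_polyC mulrA -polyCM; apply: int_polyM.
  by have /Num.Theory.intrP[n ->] := hN m; exact: int_polyC.
rewrite /mmap1; apply: (big_ind int_poly) => [||j _].
- by exists 1; rewrite rmorph1.
- exact: int_polyM.
have hX : int_poly (xy_fun (fun k => (x k)%:~R%:P)
    (fun k => a%:~R%:P * (x k)%:~R%:P + 'X * (z k)%:~R%:P) j).
  rewrite /xy_fun; case: (split j) => k; first exact: int_polyC.
  exists (a%:P * (x k)%:P + 'X * (z k)%:P).
  by rewrite rmorphD !rmorphM /= map_polyX !map_polyC.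
by elim: (m j) => [|n IH]; [exists 1; rewrite rmorph1|rewrite exprS; apply: int_polyM].
Qed.

Lemma ev_bihom (S : comNzRingType) (f : {rmorphism rat -> S}) u v (c : S) e d P :
  bihomogeneous e d P -> ev f u (fun k => c * v k) P = c ^+ d * ev f u v P.
Proof.
move=> hP; rewrite /ev /= /mmap mulr_sumr !big_seq; apply: eq_bigr => m hm.
rewrite mulrCA; congr (_ * _); have [_ <-] := hP _ hm.
rewrite /mmap1 !big_split_ord /= mulrCA; congr (_ * _).
  by apply: eq_bigr => k _; rewrite !xy_fun_l.
rewrite expr_sum -big_split /=; apply: eq_bigr => k _.
by rewrite !xy_fun_r exprMn.
Qed.

(** By homogeneity in y, P(x, a x + t z) = a^d P(x, x + (t / a) z). *)
Lemma line_qdiv x z a k e d P : a != 0 -> bihomogeneous e d P -> qdiv k P ->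
  exists r, line x z a P = 'X^k * r.
Proof.
move=> a0 hP [W hW].
have aq0 : a%:~R != 0 :> rat by rewrite intr_eq0.
pose u j : {poly rat} := (x j)%:~R%:P.
pose t : {poly rat} := 'X * (a%:~R^-1)%:P.
pose v j : {poly rat} := u j + t * (z j)%:~R%:P.
pose psi : {rmorphism {poly Qxy} -> {poly rat}} :=
  horner_eval t \o map_poly (ev polyC u (fun j => (z j)%:~R%:P)).
have hE : (psi \o subst_morph : {rmorphism Qxy -> {poly rat}}) =1 ev polyC u v.
  apply: ev_ext => [c|j|j]; rewrite /= -/(subst_morph _).
  - by rewrite /subst_morph /= mmapC /= map_polyC /= /horner_eval hornerC; exact: evC.
  - rewrite subst_x map_polyC /= /horner_eval hornerC; exact: ev_x.
  - rewrite subst_y rmorphD rmorphM /= !map_polyC map_polyX /= /horner_eval.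
    by rewrite !hornerE -/(ev _ _ _ _) -/(ev _ _ _ _) ev_x ev_y.
have hv : line x z a P = ev polyC u (fun j => a%:~R%:P * v j) P.
  apply: (ev_ext (g := line x z a)) => [c|j|j]; rewrite /line.
  - exact: evC.
  - exact: ev_x.
  rewrite ev_y /v /t mulrDr; congr (_ + _).
  by rewrite !mulrA (mulrAC _ 'X) -polyCM mulfV // mul1r.
exists (a%:~R%:P ^+ d * ((a%:~R^-1)%:P ^+ k * psi W)).
rewrite hv (ev_bihom _ _ _ _ hP) -hE /= -/(subst_morph _) -subst_morphE hW.
rewrite -[horner_eval _ _]/(psi _) rmorphM rmorphXn.
have -> : psi 'X = t.
  by rewrite /psi /= map_polyX /horner_eval hornerX.
by rewrite /t exprMn; ring.
Qed.

(** Evaluate the polynomial of [line_qdiv] at t = b.  If a = 0, rewrite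
    b z = b x + b (z - x) first. *)
Lemma ev_divisible P k e d : bihomogeneous e d P -> qdiv k P ->
  exists2 N : nat, (0 < N)%N & forall (x z : 'I_3 -> int) (a b : int),
    b != 0 -> exists m : int, N%:R *
      ev idfun (fun j => (x j)%:~R) (fun j => (a * x j + b * z j)%:~R : rat) P
      = (b ^+ k * m)%:~R.
Proof.
move=> hP hk; have [N N0 hN] := line_clear_denom P; exists N => // x z a b b0.
(* The point a x + b z is unchanged when (a, z) = (0, z) becomes (b, z - x). *)
wlog a0 : a z / a != 0.
  move=> H; have [a0|] := eqVneq a 0; last exact: H.
  have [m hm] := H b (fun j => z j - x j) b0; exists m; rewrite -hm.
  congr (_ * mmap _ (xy_fun _ _) _); apply: boolp.funext => j.
  by rewrite a0; congr (_%:~R); ring.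
have [r hr] := line_qdiv x z a0 hP hk.
rewrite -line_at hr hornerM hornerXn.
have hN' i : (N%:R * r`_i) \is a Num.int.
  by have := hN x z a (i + k)%N; rewrite hr coefXnM ltnNge leq_addl addnK.
have : (N%:R * r.[b%:~R]) \is a Num.int.
  rewrite horner_coef mulr_sumr; apply: rpred_sum => i _; rewrite mulrA.
  by apply: rpredM => //; apply: rpredX; exact: Num.Theory.intr_int.
case/Num.Theory.intrP => m hm; exists m.
by rewrite intrM -hm (rmorphXn intr k b) mulrCA.
Qed.
End Divisibility.

Section NonVanishing.
Import mpoly.

Lemma eval_intE P (x y : 'rV[int]_3) :
  eval_int P x y = ev idfun (fun j => (x 0 j)%:~R) (fun j => (y 0 j)%:~R : rat) P.
Proof.
rewrite /eval_int /meval /ev /=; congr mmap; apply: boolp.funext => i.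
by rewrite mxE /xy_fun; case: (split i).
Qed.

Definition real_pt (R : realType) (x : 'rV[int]_3) (j : 'I_3) : R := (x 0 j)%:~R.

(** A non-zero multiple of b^k is at least |b|^k in absolute value, and M bounds
    all the monomials that occur in P_E. *)
Lemma nonvanishing_bound (PE : poly_family) (R : realType) d
    (E : {set 'I_d.+1 * 'I_d.+1}) k :
  is_choice_of_P PE -> E != finset.set0 -> E \subset Tset d ->
  (#|lowset d k| < #|E|)%N ->
  exists2 K : R, 0 < K & forall (x z : 'rV[int]_3) (a b : int),
    b != 0 -> let y := a *: x + b *: z in
    eval_int (PE d E) x y != 0 -> forall M : R,
    (forall p, p \in E ->
       `|formT (real_pt R x) (real_pt R y)| ^+ (d - 2 * p.1 - 3 * p.2)
       * `|formF (real_pt R x) (real_pt R y)| ^+ p.1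
       * `|formW (real_pt R x) (real_pt R y)| ^+ p.2 <= M) ->
    `|b|%:~R ^+ k <= K * M.
Proof.
move=> hPE E0 sE ltE; have qP := qdiv_choice hPE E0 sE ltE.
have [_ [[_ bihP] [c hc]] _] := hPE d E E0 sE.
have [N N0 hN] := ev_divisible bihP qP.
exists (N%:R * (\sum_(p in E) `|ratr (c p.1 p.2)| + 1)).
  by rewrite mulr_gt0 ?ltr0n // ltr_wpDl // sumr_ge0.
move=> x z a b b0 y ne0 M hM.
have [m] := hN (x 0) (z 0) a b b0.
have -> : (fun j => (a * x 0 j + b * z 0 j)%:~R : rat) = (fun j => (y 0 j)%:~R).
  by apply: boolp.funext => j; rewrite !mxE.
rewrite -eval_intE => hm.
have m0 : m != 0.
  apply: contraNneq ne0 => m0; move: hm; rewrite m0 mulr0 => /eqP.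
  by rewrite mulf_eq0 pnatr_eq0 -leqn0 leqNgt N0 => /eqP ->.
have hv : `|ratr (eval_int (PE d E) x y)| <= (\sum_(p in E) `|ratr (c p.1 p.2)|) * M.
  have -> : eval_int (PE d E) x y = \sum_(p in E) c p.1 p.2 *
      ev idfun (fun j => (x 0 j)%:~R) (fun j => (y 0 j)%:~R) (monTFW d p.1 p.2).
    rewrite hc eval_intE raddf_sum; apply: eq_bigr => p _; exact: evZ.
  rewrite raddf_sum mulr_suml.
  apply: le_trans (ler_norm_sum _ _ _) _; apply: ler_sum => p hp.
  rewrite ev_mon /= (rmorphM ratr) normrM.
  apply: ler_wpM2l => //; apply: le_trans (hM p hp).
  have hx (v : 'rV[int]_3) : ratr \o (fun j => (v 0 j)%:~R) = real_pt R v.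
    by apply: boolp.funext => j; rewrite /= ratr_int.
  rewrite 2!(rmorphM ratr) (rmorphXn ratr) (rmorphXn ratr p.1) (rmorphXn ratr p.2).
  rewrite (rmorph_formT ratr) (rmorph_formF ratr) (rmorph_formW ratr) !hx.
  by rewrite normrM (normrM (_ ^+ _)) !normrX.
have M0 : 0 <= M.
  have /finset.set0Pn[p hp] := E0.
  by apply: le_trans (hM p hp); rewrite !mulr_ge0 // exprn_ge0.
apply: le_trans (_ : `|(b ^+ k * m)%:~R| <= _).
  rewrite -intr_norm normrM normrX -rmorphXn ler_int.
  by rewrite ler_peMr ?exprn_ge0 // -gtz0_ge1 normr_gt0.
have -> : (b ^+ k * m)%:~R = ratr (b ^+ k * m)%:~R :> R by rewrite ratr_int.
rewrite -hm rmorphM normrM rmorph_nat normr_nat -mulrA ler_wpM2l ?ler0n //.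
by apply: le_trans hv _; rewrite ler_wpM2r // lerDl.
Qed.
End NonVanishing.

(** * Counting lattice points in triangles *)

Section Count.
Variable R : realFieldType.
Implicit Types p q r s : R.

Lemma count_below q s N : 0 < q -> 0 <= s + q ->
  (\sum_(n < N) (q * n%:R < s)%R)%N%:R <= (s + q) / q :> R.
Proof.
move=> q0; elim: N s => [|N IH] s hs; first by rewrite big_ord0 divr_ge0 // ltW.
have [s0|s0] := leP s 0.
  rewrite big1 ?divr_ge0 // ?(ltW q0) // => n _.
  by rewrite ltNge (le_trans s0) ?mulr_ge0 // ltW.
rewrite big_ord_recl mulr0 s0 natrD.
have -> : (\sum_(i < N) (q * (lift ord0 i)%:R < s)%R = \sum_(i < N) (q * i%:R < s - q)%R)%N.
  apply: eq_bigr => i _; congr (nat_of_bool _).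
  by rewrite lift0 -natr1 mulrDr mulr1 ltrBrDr.
have := IH (s - q); rewrite subrK => /(_ (ltW s0)) h.
by rewrite mulrDl divff ?gt_eqF // addrC lerD2r.
Qed.

(** Removing the column m = 0 replaces r by r - p; the column itself is bounded
    by [count_below], and (r + p + q)^2 / (2pq) increases by more than that. *)
Lemma count_triangle p q r M N : 0 < p -> 0 < q ->
  (\sum_(m < M) \sum_(n < N) (p * m%:R + q * n%:R < r)%R)%N%:R
    <= (r + p + q) ^+ 2 / (2 * p * q) :> R.
Proof.
move=> p0 q0; have pq0 : 0 < 2 * p * q by rewrite !mulr_gt0.
elim: M r => [|M IH] r; first by rewrite big_ord0 divr_ge0 ?sqr_ge0 // ltW.
have [r0|r0] := leP r 0.
  rewrite big1 ?divr_ge0 ?sqr_ge0 // ?(ltW pq0) // => m _; rewrite big1 // => n _.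
  by rewrite ltNge (le_trans r0) // addr_ge0 // mulr_ge0 // ltW.
rewrite big_ord_recl natrD.
have h1 : (\sum_(n < N) (p * (@ord0 M)%:R + q * n%:R < r)%R)%N%:R <= (r + q) / q.
  under eq_bigr do rewrite mulr0 add0r.
  by apply: count_below => //; rewrite addr_ge0 // ltW.
have h2 : (\sum_(m < M) \sum_(n < N)
     (p * (lift ord0 m)%:R + q * n%:R < r)%R)%N%:R <= (r + q) ^+ 2 / (2 * p * q).
  have := IH (r - p); rewrite subrK; congr (_ <= _); congr (_%:R).
  apply: eq_bigr => i _; apply: eq_bigr => n _; congr (nat_of_bool _).
  by rewrite lift0 -natr1 mulrDr mulr1 addrAC ltrBrDr.
apply: le_trans (lerD h1 h2) _.
rewrite -subr_ge0.
have -> : (r + p + q) ^+ 2 / (2 * p * q) - ((r + q) / q + (r + q) ^+ 2 / (2 * p * q))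
  = p / (2 * q).
  by field; rewrite !gt_eqF.
by rewrite divr_ge0 ?mulr_ge0 // ltW.
Qed.

Lemma count_mult3 d N : (d < N)%N -> (d < 3 * \sum_(n < N) (3 * n <= d))%N.
Proof.
elim/ltn_ind: d N => d IH [//|N] hN; rewrite big_ord_recl /=.
have [d3|d3] := ltnP d 3; first by lia.
have -> : (\sum_(i < N) (3 * bump 0 i <= d) = \sum_(i < N) (3 * i <= d - 3))%N.
  by apply: eq_bigr => i _; congr (nat_of_bool _); rewrite /bump; lia.
have := IH (d - 3)%N _ N; lia.
Qed.

(** The same induction, with d replaced by d - 2. *)
Lemma count_weight23 d M N : (d < M)%N -> (d < N)%N ->
  (d.+1 ^ 2 <= 12 * \sum_(m < M) \sum_(n < N) (2 * m + 3 * n <= d))%N.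
Proof.
elim/ltn_ind: d M => d IH [//|M] hM hN; rewrite big_ord_recl /= muln0.
have := count_mult3 hN; set S0 := (\sum_(n < N) _)%N => h1.
have [d2|d2] := ltnP d 2.
  apply: leq_trans (_ : 4 * d.+1 <= _)%N; last by lia.
  by case: d d2 {IH hM hN S0 h1} => [|[|]].
have -> : (\sum_(i < M) \sum_(n < N) (2 * bump 0 i + 3 * n <= d)
         = \sum_(i < M) \sum_(n < N) (2 * i + 3 * n <= d - 2))%N.
  apply: eq_bigr => i _; apply: eq_bigr => n _; congr (nat_of_bool _).
  by rewrite /bump; lia.
have hd : (d - 2 < d)%N by lia.
have := IH (d - 2)%N hd M; nia.
Qed.

Lemma card_grid d (P : nat -> nat -> bool) :
  #|[set p : 'I_d.+1 * 'I_d.+1 | P p.1 p.2]|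
  = (\sum_(m < d.+1) \sum_(n < d.+1) P m n)%N.
Proof.
rewrite -sum1dep_card big_mkcond pair_bigA /=.
by apply: eq_bigr => p _; case: (P _ _).
Qed.

(** The complement in T_d of a corner at the origin, that is at the monomial
    T^d. *)
Definition halfplane d p q r : {set 'I_d.+1 * 'I_d.+1} :=
  [set t in Tset d | r <= p * (t.1 : nat)%:R + q * (t.2 : nat)%:R].

(** Both [lowset d k] and the removed corner are triangles, whose numbers of
    lattice points are comparable to their areas; T_d has at least d^2 / 12. *)
Lemma card_low_lt_halfplane d k p q r : 0 < p -> 0 < q ->
  (k%:R + 5) ^+ 2 / 12 + (r + p + q) ^+ 2 / (2 * p * q) < d%:R ^+ 2 / 12 ->
  (#|lowset d k| < #|halfplane d p q r|)%N.
Proof.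
move=> p0 q0 h.
pose X := [set t : 'I_d.+1 * 'I_d.+1 |
            p * (t.1 : nat)%:R + q * (t.2 : nat)%:R < r].
have hX : #|X|%:R <= (r + p + q) ^+ 2 / (2 * p * q).
  by rewrite (card_grid d (fun m n => p * m%:R + q * n%:R < r)); exact: count_triangle.
have hL : #|lowset d k|%:R <= (k%:R + 5) ^+ 2 / 12 :> R.
  pose L := [set t : 'I_d.+1 * 'I_d.+1 | (2 * t.1 + 3 * t.2 < k)%N].
  have hsub : lowset d k \subset L.
    by apply/fintype.subsetP => t; rewrite !inE => /andP[].
  apply: le_trans (_ : #|L|%:R <= _); first by rewrite ler_nat subset_leq_card.
  rewrite (card_grid d (fun m n => 2 * m + 3 * n < k)%N).
  have := @count_triangle 2 3 k%:R d.+1 d.+1; rewrite !ltr0n => /(_ isT isT).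
  have -> : k%:R + 2 + 3 = k%:R + 5 :> R by ring.
  have -> : 2 * 2 * 3 = 12 :> R by ring.
  congr (_%:R <= _); apply: eq_bigr => m _; apply: eq_bigr => n _.
  by congr (nat_of_bool _); rewrite -!natrM -natrD ltr_nat.
have hT : d%:R ^+ 2 / 12 <= #|Tset d|%:R :> R.
  rewrite /Tset (card_grid d (fun m n => 2 * m + 3 * n <= d)%N).
  rewrite ler_pdivrMr ?ltr0n // -natrX -natrM ler_nat mulnC.
  apply: leq_trans (count_weight23 (ltnSn d) (ltnSn d)).
  by rewrite leq_exp2r.
have hc : (#|Tset d| <= #|halfplane d p q r| + #|X|)%N.
  apply: leq_trans (leq_card_setU _ _).
  apply/subset_leq_card/fintype.subsetP => t ht.
  by rewrite finset.in_setU !inE leNgt; case: (_ < r); rewrite ?orbT //; move: ht; rewrite inE => ->.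
move: hc; rewrite -(ler_nat R) natrD -(ltr_nat R) => hc.
lra.
Qed.
End Count.

(** * The quadratic inequality behind the exponent (1 + 3 sqrt 5) / 11 *)

Section Numeric.
Variable R : realFieldType.
Implicit Types l u w : R.

(** The cofactor in [quadratic_gap] of the distance w of l (1 - l) u to its
    smallest admissible value 3l - 2. *)
Definition gap_cofactor l w : R :=
  (-96 + 288 * l - 807 * l ^+ 3 + 942 * l ^+ 4 - 327 * l ^+ 5)
  + (72 - 144 * l - 110 * l ^+ 2 + 382 * l ^+ 3 - 201 * l ^+ 4) * w
  + (-24 + 24 * l + 50 * l ^+ 2 - 53 * l ^+ 3) * w ^+ 2
  + (3 - 5 * l ^+ 2) * w ^+ 3.

(** Expand around l = 7/10: on this small box the constant term dominates. *)
Lemma gap_cofactor_ge0 l w : 7 / 10 <= l <= 71 / 100 -> 0 <= w <= 1 / 20 ->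
  0 <= gap_cofactor l w.
Proof.
move=> /andP[hl1 hl2] /andP[w0 w1].
pose x := l - 7 / 10.
have hx0 : 0 <= x by rewrite /x; lra.
have hx1 : x <= 1 / 100 by rewrite /x; lra.
have -> : l = 7 / 10 + x by rewrite /x; ring.
clearbody x; clear hl1 hl2 l.
have hx n : 0 <= x ^+ n.+2 <= x ^+ n.+1 / 100.
  rewrite exprn_ge0 //= exprSr ler_wpM2l ?exprn_ge0 //; lra.
have [/andP[? ?] /andP[? ?] /andP[? ?] /andP[? ?]] :=
  And4 (hx 0%N) (hx 1%N) (hx 2%N) (hx 3%N).
have w2 : 0 <= w ^+ 2 <= w / 20 by nra.
have w3 : 0 <= w ^+ 3 <= w / 400 by rewrite (exprS w 2); nra.
have h1 : 1 / 100 <= -96 + 288 * (7/10+x) - 807 * (7/10+x) ^+ 3 + 942 * (7/10+x) ^+ 4 - 327 * (7/10+x) ^+ 5.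
  by lra.
have h2 : -1/10 <= 72 - 144 * (7/10+x) - 110 * (7/10+x) ^+ 2 + 382 * (7/10+x) ^+ 3 - 201 * (7/10+x) ^+ 4.
  by lra.
have h3 : -1 <= -24 + 24 * (7/10+x) + 50 * (7/10+x) ^+ 2 - 53 * (7/10+x) ^+ 3.
  by lra.
have h4 : 0 <= 3 - 5 * (7/10+x) ^+ 2 by lra.
rewrite /gap_cofactor; nra.
Qed.

(** Here s bounds the exponent of X_i relative to X_j, and T, f, v, g are the
    costs and the gain.  Up to the positive denominator
    3 l^4 (1-l)^2 (1 - (1-l)u)^2, the right-hand side equals
    6 (1-l)^3 (3l-2)(11 l^2 - 2l - 4) + w H(l, w), with H the cofactor above and
    w = l(1-l)u - (3l-2). *)
Lemma quadratic_gap l u (m := 1 - l) (s := m * u / (1 - m * u))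
    (T := 1 + s - l * u) (f := 1 - 2 * l * u)
    (v := (4 * s + 2 - l / m - l * u) / 3) (g := 1 - u) :
  7 / 10 <= l <= 71 / 100 -> 0 <= 11 * l ^+ 2 - 2 * l - 4 ->
  3 * l - 2 <= u * l * m -> 2 * l * u <= 1 ->
  2 * (1 - l) ^+ 3 * (3 * l - 2) * (11 * l ^+ 2 - 2 * l - 4)
    <= g ^+ 2 - T * (f + v) + f * v.
Proof.
move=> hl he h1 h2; have /andP[hl1 hl2] := hl.
pose w := u * l * m - (3 * l - 2).
have m0 : 0 < m by rewrite /m; lra.
have u0 : 0 < u.
  have lm0 : 0 < l * m by rewrite mulr_gt0 //; lra.
  by rewrite -(pmulr_lgt0 _ lm0) mulrA; apply: lt_le_trans h1; lra.
have u1 : u <= 72 / 100 by nra.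
have sg : 0 < 1 - m * u by rewrite /m; nra.
have w0 : 0 <= w by rewrite /w subr_ge0.
have w1 : w <= 1 / 20 by rewrite /w /m; nra.
have hH := @gap_cofactor_ge0 l w hl; rewrite w0 w1 in hH.
set e := 11 * l ^+ 2 - 2 * l - 4 in he *.
set Z := 3 * l ^+ 4 * m ^+ 2 * (1 - m * u) ^+ 2.
have Z0 : 0 < Z by rewrite /Z !mulr_gt0 ?exprn_gt0 //; lra.
have Z1 : Z <= 3.
  have hl4 : l ^+ 4 <= 1 by rewrite exprn_ile1 //; lra.
  have hm : m ^+ 2 <= 1 by rewrite exprn_ile1 ?(ltW m0) // /m; lra.
  have hs : (1 - m * u) ^+ 2 <= 1.
    by rewrite exprn_ile1 ?(ltW sg) // lerBlDr lerDl mulr_ge0 // ltW.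
  have hl0 : 0 <= l ^+ 4 by rewrite exprn_ge0; lra.
  have hm0 := sqr_ge0 m; have hs0 := sqr_ge0 (1 - m * u).
  have hms : m ^+ 2 * (1 - m * u) ^+ 2 <= 1 by rewrite mulr_ile1.
  have h4 : l ^+ 4 * (m ^+ 2 * (1 - m * u) ^+ 2) <= 1.
    by rewrite mulr_ile1 // mulr_ge0.
  by move: h4; rewrite /Z -!mulrA; lra.
rewrite [leRHS](_ : _ =
  (e * (6 * (1 - l) ^+ 3 * (3 * l - 2)) + w * gap_cofactor l w) / Z); last first.
  rewrite /g /T /f /v /s /Z /e /w /gap_cofactor /m.
  field; apply/and3P; split; apply: lt0r_neq0 => //; rewrite ?/m; lra.
have q0 : 0 <= (1 - l) ^+ 3 * (3 * l - 2) by rewrite mulr_ge0 ?exprn_ge0 //; lra.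
rewrite ler_pdivlMr //.
have := mulr_ge0 he q0; have := mulr_ge0 w0 (hH isT).
pose B := e * ((1 - l) ^+ 3 * (3 * l - 2)); rewrite -/B => hA hB.
have -> : 2 * (1 - l) ^+ 3 * (3 * l - 2) * e = 2 * B by rewrite /B; ring.
have -> : e * (6 * (1 - l) ^+ 3 * (3 * l - 2)) = 6 * B by rewrite /B; ring.
have : 2 * B * Z <= 2 * B * 3 by rewrite ler_wpM2l // mulr_ge0.
lra.
Qed.
End Numeric.

(** * Choice of the degree and of the valuation *)

Section Degree.
Variable R : realFieldType.

(** Cauchy-Schwarz: the minimum of a^2 + (T - g a)^2 / D is T^2 / (g^2 + D). *)
Lemma ellipse_optimum (T g D : R) : 0 <= T <= 2 -> 1 / 4 <= g -> 0 < D ->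
  exists a : R, [/\ 0 <= a <= 8, 0 <= T - g * a <= 2
    & a ^+ 2 + (T - g * a) ^+ 2 / D = T ^+ 2 / (g ^+ 2 + D)].
Proof.
move=> /andP[T0 T2] g1 D0.
have g0 : 0 < g by lra.
have gg0 : 0 < g ^+ 2 by rewrite exprn_gt0.
have [S SE] : exists S, S = g ^+ 2 + D by exists (g ^+ 2 + D).
have S0 : 0 < S by rewrite SE addr_gt0.
exists (g * T / S).
have TC : T - g * (g * T / S) = T * D / S.
  by rewrite (_ : D = S - g ^+ 2); [field; rewrite gt_eqF|rewrite SE; ring].
have a0 : 0 <= g * T / S by rewrite divr_ge0 ?mulr_ge0 // ltW.
split.
- rewrite a0 ler_pdivrMr // SE mulrDr.
  apply: le_trans (_ : 8 * g ^+ 2 <= _); last by rewrite lerDl mulr_ge0 // ltW.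
  by rewrite expr2 mulrA mulrC ler_wpM2r ?(ltW g0) //; lra.
- rewrite TC divr_ge0 ?mulr_ge0 ?(ltW D0) ?(ltW S0) //= -TC.
  by apply: le_trans T2; rewrite lerBlDr lerDl mulr_ge0 // ltW.
rewrite TC -SE (_ : D = S - g ^+ 2); last by rewrite SE; ring.
have D0' : S - g ^+ 2 != 0 by rewrite SE addrC addKr gt_eqF.
by field; rewrite D0' gt_eqF.
Qed.

(** Rounding k up and the boundary terms of the lattice point counts cost only
    O(x), against a main term of order x^2. *)
Lemma rounding_cost (x a y c D k : R) : 0 <= x -> 0 <= a <= 8 ->
  0 <= k <= x * a + 1 -> 0 <= y <= 2 -> 0 <= c <= 10 -> 1 / 16 <= D ->
  (k + 5) ^+ 2 + (x * y + c) ^+ 2 / D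
    <= x ^+ 2 * (a ^+ 2 + y ^+ 2 / D) + (736 * x + 1636).
Proof.
move=> x0 /andP[a0 a8] /andP[k0 k1] /andP[y0 y2] /andP[c0 c10] D1.
have e1 : (k + 5) ^+ 2 <= x ^+ 2 * a ^+ 2 + 96 * x + 36.
  apply: le_trans (_ : (x * a + 6) ^+ 2 <= _).
    by rewrite lerXn2r ?nnegrE //; lra.
  have : x * a <= x * 8 by rewrite ler_wpM2l.
  rewrite sqrrD exprMn; lra.
have D0 : 0 < D by lra.
have e2 : (x * y + c) ^+ 2 / D <= x ^+ 2 * (y ^+ 2 / D) + 640 * x + 1600.
  have Di : D^-1 <= 16.
    by rewrite -[leLHS]mul1r ler_pdivrMr //; lra.
  have Di0 : 0 <= D^-1 by rewrite invr_ge0 ltW.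
  have -> : (x * y + c) ^+ 2 / D = x ^+ 2 * (y ^+ 2 / D)
     + (2 * (x * (y * c)) + c ^+ 2) * D^-1 by ring.
  rewrite -addrA lerD2l.
  have h3 : 0 <= y * c <= 20.
    by rewrite mulr_ge0 //= (_ : 20 = 2 * 10) ?ler_pM //; ring.
  have h4 : 0 <= x * (y * c) <= x * 20.
    by case/andP: h3 => ? ?; rewrite mulr_ge0 //= ler_wpM2l.
  have h5 : 0 <= c ^+ 2 <= 100.
    by rewrite sqr_ge0 /= (_ : 100 = 10 ^+ 2) ?lerXn2r ?nnegrE //; ring.
  apply: le_trans (_ : (40 * x + 100) * 16 <= _); last lra.
  by apply: ler_pM => //; lra.
have := lerD e1 e2; rewrite mulrDr; lra.
Qed.
End Degree.

(** F and V stand for the differences T - f and T - v of costs.  For C = g a and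
    k close to a d the two sides differ by the factor T^2 / (g^2 + F V) to the
    second order in d, which is less than 1 by a fixed amount. *)
Lemma degree_choice (R : archiRealFieldType) (delta : R) : 0 < delta ->
  exists d0 : nat, forall d : nat, (d0 <= d)%N -> forall T F V g : R,
  0 <= T <= 2 -> 1 / 4 <= F <= 2 -> 1 / 4 <= V <= 2 -> 1 / 4 <= g <= 1 ->
  T ^+ 2 + delta <= g ^+ 2 + F * V ->
  exists (k : nat) (C : R), C * d%:R <= g * k%:R /\
    (k%:R + 5) ^+ 2 / 12
    + (d%:R * (T - C) + 2 * F + 3 * V) ^+ 2 / (2 * (2 * F) * (3 * V))
      < d%:R ^+ 2 / 12.
Proof.
move=> de0; exists (Num.truncn (12000 / delta)).+1 => d hd T F V g.
move=> T02 /andP[F1 F2] /andP[V1 V2] /andP[g1 g2] hyp.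
have dd : 12000 < delta * d%:R.
  rewrite mulrC -ltr_pdivrMr //; apply: lt_le_trans (Num.Theory.truncnS_gt _) _.
  by rewrite ler_nat.
have d1 : 1 <= d%:R :> R.
  by rewrite ler1n; apply: leq_trans hd.
move: d%:R dd d1 => x dd d1 {hd d}.
have F0 : 0 < F by apply: lt_le_trans F1; rewrite divr_gt0.
have V0 : 0 < V by apply: lt_le_trans V1; rewrite divr_gt0.
have [D DE] : exists D, D = F * V by exists (F * V).
have D1 : 1 / 16 <= D.
  rewrite DE (_ : 1 / 16 = (1 / 4) * (1 / 4)); last by field.
  by rewrite ler_pM // divr_ge0.
have D4 : D <= 4.
  by rewrite DE (_ : 4 = 2 * 2); [rewrite ler_pM // ltW|ring].
have D0 : 0 < D by rewrite DE mulr_gt0.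
have [a [a08 y02 aE]] := ellipse_optimum T02 g1 D0.
pose k := (Num.truncn (x * a)).+1.
have x0 : 0 <= x by apply: le_trans d1.
have a0 : 0 <= a by case/andP: a08.
have k1 : x * a <= k%:R by rewrite ltW // Num.Theory.truncnS_gt.
have k2 : k%:R <= x * a + 1.
  by rewrite /k -natr1 lerD2r Num.Theory.truncn_le mulr_ge0.
exists k, (g * a); split.
  rewrite -mulrA (mulrC a) ler_wpM2l //.
  by apply: le_trans g1; rewrite divr_ge0.
have -> : 2 * (2 * F) * (3 * V) = 12 * D by rewrite DE; ring.
rewrite -(addrA (x * _)) invfM (mulrC 12^-1) mulrA -mulrDl.
rewrite ltr_pM2r ?invr_gt0 //.
apply: le_lt_trans (rounding_cost x0 a08 _ y02 _ D1) _.
- by rewrite ler0n.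
- clear -F0 V0 F2 V2; lra.
rewrite aE -DE in hyp *.
have S0 : 0 < g ^+ 2 + D by rewrite ltr_wpDl // sqr_ge0.
have S5 : g ^+ 2 + D <= 5.
  rewrite (_ : 5 = 1 + 4); last by ring.
  rewrite lerD // expr_le1 //; by apply: le_trans g1; rewrite divr_ge0.
have key : T ^+ 2 / (g ^+ 2 + D) <= 1 - delta / 5.
  rewrite ler_pdivrMr // mulrBl mul1r lerBrDr; apply: le_trans hyp; rewrite lerD2l.
  by rewrite mulrAC ler_pdivrMr // ler_wpM2l // ltW.
have h6 := ler_wpM2l (sqr_ge0 x) key.
have h7 : 12000 * x < delta * x * x by rewrite ltr_pM2r //; apply: lt_le_trans d1.
clear -h6 h7 d1.
rewrite mulrBr mulr1 in h6.
have h8 : x ^+ 2 * (delta / 5) = delta * x * x / 5 by ring.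
rewrite h8 in h6; lra.
Qed.

Local Notation expR := sequences.expR.
(** * A pair of points obeying the growth conditions is a zero *)

Section Pair.
Variable R : realType.

(** For k > d the set [lowset d k] is the whole of T_d. *)
Lemma lowset_lt_le d (E : {set 'I_d.+1 * 'I_d.+1}) k :
  E \subset Tset d -> (#|lowset d k| < #|E|)%N -> (k <= d)%N.
Proof.
move=> sE; apply: contraTT; rewrite -leqNgt -ltnNge => dk.
apply/subset_leq_card/(fintype.subset_trans sE)/fintype.subsetP => t.
by rewrite !inE => ht; rewrite ht (leq_ltn_trans ht dk).
Qed.

(** There are finitely many E, and only k <= d matters. *)
Lemma uniform_nonvanishing_bound (PE : poly_family) d : is_choice_of_P PE ->
  exists2 K : R, 0 < K &
  forall (E : {set 'I_d.+1 * 'I_d.+1}) k, E != finset.set0 -> E \subset Tset d ->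
  (#|lowset d k| < #|E|)%N ->
  forall (x z : 'rV[int]_3) (a b : int),
    b != 0 -> let y := a *: x + b *: z in
    eval_int (PE d E) x y != 0 -> forall M : R,
    (forall p, p \in E ->
       `|formT (real_pt R x) (real_pt R y)| ^+ (d - 2 * p.1 - 3 * p.2)
       * `|formF (real_pt R x) (real_pt R y)| ^+ p.1
       * `|formW (real_pt R x) (real_pt R y)| ^+ p.2 <= M) ->
    `|b|%:~R ^+ k <= K * M.
Proof.
move=> hPE; pose ok (E : {set 'I_d.+1 * 'I_d.+1}) k :=
  [&& E != finset.set0, E \subset Tset d & (#|lowset d k| < #|E|)%N].
have ex (t : {set 'I_d.+1 * 'I_d.+1} * 'I_d.+1) : exists K : R, 0 <= K /\ (ok t.1 t.2 ->
  forall (x z : 'rV[int]_3) (a b : int),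
    b != 0 -> let y := a *: x + b *: z in
    eval_int (PE d t.1) x y != 0 -> forall M : R,
    (forall p, p \in t.1 ->
       `|formT (real_pt R x) (real_pt R y)| ^+ (d - 2 * p.1 - 3 * p.2)
       * `|formF (real_pt R x) (real_pt R y)| ^+ p.1
       * `|formW (real_pt R x) (real_pt R y)| ^+ p.2 <= M) ->
    `|b|%:~R ^+ t.2 <= K * M).
  have [/and3P[h1 h2 h3]|] := boolP (ok t.1 t.2); last by exists 0.
  have [K K0 hK] := nonvanishing_bound R hPE h1 h2 h3.
  by exists K; split=> [|_]; [exact: ltW|exact: hK].
have [K hK] := fin_all_exists ex.
have K0 t : 0 <= K t by case: (hK t).
exists (\sum_t K t + 1); first by rewrite ltr_wpDl ?sumr_ge0.
move=> E k h1 h2 h3 x z a b b0 y ne0 M hM.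
have kd := lowset_lt_le h2 h3.
have [_] := hK (E, inord k); rewrite /ok /= inordK // h1 h2 h3 => /(_ isT) hb.
apply: le_trans (hb x z a b b0 ne0 M hM) _.
have M0 : 0 <= M.
  have /finset.set0Pn[p hp] := h1.
  by apply: le_trans (hM p hp); rewrite !mulr_ge0 // exprn_ge0.
apply: ler_wpM2r => //; rewrite (bigD1 (E, inord k)) //= -addrA lerDl.
by rewrite addr_ge0 // sumr_ge0.
Qed.

(** The numbers A, B, A', B' stand for the logarithms of X_i, X_{i+1}, X_j,
    X_{j+1}, and l for an exponent slightly below lambda; M absorbs all the
    multiplicative constants. *)
Record log_bounds (l M : R) (x y : 'rV[int]_3) (A B A' B' : R) : Prop := {
  lb_T : `|formT (real_pt R x) (real_pt R y)| <= expR (A + A' - l * B - M);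
  lb_F : `|formF (real_pt R x) (real_pt R y)| <=
     expR (Num.max (3 * A + A' - l * B - l * B') (2 * A' - 4 * l * B) - M);
  lb_W : `|formW (real_pt R x) (real_pt R y)| <=
     expR (4 * A + 2 * A' - 2 * l * B - l * B' - M) }.

(** The last field is the height inequality for the previous pair (h, i), with
    X_{h+1} replaced by X_i^u, u = B / A'; it is available when u has not dropped
    from the previous pair to this one. *)
Record growth (l A B A' B' : R) : Prop := {
  gr_pos : 0 < A';
  gr_A : 0 <= A;
  gr_B : 0 <= B;
  gr_BA : B <= A';
  gr_heights : A' <= (1 - l) * (B + B');
  gr_phi : l * B' <= 2 * A';
  gr_prev : A <= (1 - l) * (B / A' * A + B) }.

(** From A <= (1-l) B / l, B <= A' and B + B' >= A' / (1-l), this exponent is at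
    most (3 (1-l) / l + 1 - l / (1-l)) A', which is negative once l >= 7/10. *)
Lemma growth_F l A B A' B' : 7 / 10 <= l <= 71 / 100 -> growth l A B A' B' ->
  3 * A + A' - l * B - l * B' <= 0.
Proof.
move=> hl [A'0 A0 B0 BA hh hphi hprev].
have BA1 : B / A' <= 1 by rewrite ler_pdivrMr // mul1r.
have h1 : l * A <= (1 - l) * B.
  have : (1 - l) * (B / A' * A + B) <= (1 - l) * (A + B).
    by apply: ler_wpM2l; [lra|rewrite lerD2r ler_piMl].
  lra.
have h2 : 7 * A <= 3 * B by nra.
have h3 : 7 * A' <= 3 * (l * (B + B')) by nra.
clear -h2 h3 BA A'0; lra.
Qed.

Lemma weight_split d m n : (2 * m + 3 * n <= d)%N ->
  (d - 2 * m - 3 * n + 2 * m + 3 * n = d)%N.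
Proof. lia. Qed.

Lemma weight_split_gt0 d m n : (0 < d)%N -> (2 * m + 3 * n <= d)%N ->
  (0 < d - 2 * m - 3 * n + m + n)%N.
Proof. lia. Qed.

(** If 2 l B >= A', then the bound for F alone is below 1 and E = {F^{d/2}}, k = 0
    suffice.  Otherwise [quadratic_gap] feeds [degree_choice]. *)
Lemma pair_forces_vanishing (PE : poly_family) l : is_choice_of_P PE ->
  7 / 10 <= l <= 71 / 100 ->
  0 < 11 * l ^+ 2 - 2 * l - 4 ->
  exists (d : nat) (M : R), (0 < d)%N /\
  forall (x z : 'rV[int]_3) (a b : int) A B A' B', b != 0 ->
    let y := a *: x + b *: z in
    expR (A' - B) / 3 <= `|b|%:~R ->
    growth l A B A' B' -> log_bounds l M x y A B A' B' ->
    exists E : {set 'I_d.+1 * 'I_d.+1},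
      [/\ E != finset.set0, E \subset Tset d & eval_int (PE d E) x y = 0].
Proof.
move=> hPE hl he; have /andP[hl1 hl2] := hl.
pose delta := 2 * (1 - l) ^+ 3 * (3 * l - 2) * (11 * l ^+ 2 - 2 * l - 4).
have delta0 : 0 < delta.
  by rewrite /delta !mulr_gt0 ?exprn_gt0 //; lra.
have [d0 hd0] := degree_choice delta0.
pose d := (2 * d0.+1)%N.
have [K K0 hK] := uniform_nonvanishing_bound d hPE.
(* The factor 3^d makes up for the constant in |b| >= X_j / (3 X_{i+1}). *)
pose M := ln (1 + K * 3 ^+ d).
have K3 : 0 < K * 3 ^+ d by rewrite mulr_gt0 // exprn_gt0.
have eM : expR M = 1 + K * 3 ^+ d by rewrite lnK // posrE ltr_wpDl.
have M0 : 0 <= M by rewrite ln_ge0 // lerDl ltW.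
exists d, M; split=> // x z a b A B A' B' b0 y hb gr [hT hF hW].
have [A'0 A0 B0 BA hh hphi hprev] := gr.
have hF1 := growth_F hl gr.
have small k : (k <= d)%N -> K * expR (- M) < (1 / 3) ^+ k.
  move=> kd; rewrite expRN eM ltr_pdivrMr ?ltr_wpDl // div1r exprVn.
  rewrite ltr_pdivlMl ?exprn_gt0 //.
  have : 3 ^+ k <= 3 ^+ d :> R by apply: ler_weXn2l => //; lra.
  move=> /(ler_wpM2r (ltW K0)); rewrite (mulrC (3 ^+ d)); lra.
(* In the first case F has become small by itself. *)
have [hA|hB] := leP A' (2 * l * B).
  pose h := d0.+1.
  have hh1 : (h < d.+1)%N by rewrite ltnS /h /d mul2n -addnn leq_addr.
  pose t : 'I_d.+1 * 'I_d.+1 := (Ordinal hh1, ord0).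
  pose E := [set t].
  have E0 : E != finset.set0 by apply/finset.set0Pn; exists t; rewrite inE.
  have sE : E \subset Tset d.
    by apply/fintype.subsetP => u; rewrite !inE => /eqP ->; rewrite /t /= muln0 addn0.
  have hlow : (#|lowset d 0| < #|E|)%N.
    by rewrite cards1 ltnS leqn0 cards_eq0; apply/eqP/setP => u; rewrite !inE ltn0 andbF.
  exists E; split=> //; apply/eqP; apply: contraT => ne0.
  suff hp p : p \in E ->
       `|formT (real_pt R x) (real_pt R y)| ^+ (d - 2 * p.1 - 3 * p.2)
       * `|formF (real_pt R x) (real_pt R y)| ^+ p.1
       * `|formW (real_pt R x) (real_pt R y)| ^+ p.2 <= expR (- M).
    have := hK E 0%N E0 sE hlow x z a b b0 ne0 _ hp; have := small 0%N isT.
    by rewrite !expr0 ltNge => /negP.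
  rewrite !inE => /eqP ->; rewrite /t /=.
  have -> : (d - 2 * h - 3 * 0 = 0)%N by rewrite muln0 subn0 subnn.
  rewrite !expr0 mul1r mulr1.
  have hF' : `|formF (real_pt R x) (real_pt R y)| <= expR (- M).
    apply: le_trans hF _; rewrite ler_expR gerDr ge_max hF1 /=; lra.
  apply: le_trans (_ : expR (- M) ^+ h <= _); first by rewrite lerXn2r ?nnegrE ?expR_ge0.
  rewrite /h exprS ler_piMr ?expR_ge0 // exprn_ile1 ?expR_ge0 //.
  by rewrite -expR0 ler_expR oppr_le0.
pose m := 1 - l.
pose u := B / A'.
have BE : B = u * A' by rewrite /u divfK // gt_eqF.
have u0 : 0 <= u by rewrite divr_ge0 // ltW.
have lu1 : 2 * l * u <= 1.
  by rewrite /u mulrA ler_pdivrMr // mul1r ltW.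
have uu : 3 * l - 2 <= u * l * m.
  rewrite -(ler_pM2r A'0) /m.
  have : A' * l <= (1 - l) * (u * A' + B') * l by rewrite ler_wpM2r -?BE //; lra.
  have : (1 - l) * (l * B') <= (1 - l) * (2 * A') by rewrite ler_wpM2l //; lra.
  clear; lra.
have mu1 : m * u < 1 / 2 by rewrite /m; nra.
have sg : 0 < 1 - m * u by lra.
pose s := m * u / (1 - m * u).
(* Costs per unit of weight, and gain, on the scale where log X_j = 1. *)
pose T := 1 + s - l * u; pose f := 1 - 2 * l * u.
pose v := (4 * s + 2 - l / m - l * u) / 3; pose g := 1 - u.
have As : A <= s * A'.
  rewrite /s -mulrA mulrC -mulrA (mulrC _^-1) mulrA ler_pdivlMr //.
  move: hprev; rewrite -/u -/m BE; clear; lra.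
have core : T ^+ 2 + delta <= g ^+ 2 + (T - f) * (T - v).
  have := quadratic_gap hl (ltW he) uu lu1.
  rewrite -/delta -/m -/s -/T -/f -/v -/g; clear; lra.
have u1 : 47 / 100 <= u.
  have lm : l * m <= 21 / 100 by rewrite /m; clear -hl1 hl2; nra.
  have : u * (l * m) <= u * (21 / 100) by rewrite ler_wpM2l.
  move: uu; clear -hl1; lra.
have u2 : u <= 72 / 100 by clear -lu1 hl1 u0; nra.
have lu2 : 32 / 100 <= l * u by clear -hl1 u1; nra.
have s0 : 0 <= s by rewrite divr_ge0 ?(ltW sg) // mulr_ge0 // /m; clear -hl2; lra.
have s1 : s <= 28 / 100.
  rewrite /s ler_pdivrMr //.
  have : m * u <= 30 / 100 * (72 / 100) by rewrite ler_pM // /m; clear -hl1 hl2; lra.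
  clear; lra.
have lm1 : 2 <= l / m.
  by rewrite ler_pdivlMr /m; clear -hl1 hl2; lra.
have T02 : 0 <= T <= 2 by rewrite /T; clear -s0 s1 lu2 lu1; lra.
have F02 : 1 / 4 <= T - f <= 2 by rewrite /T /f; clear -s0 s1 lu2 lu1; lra.
have V02 : 1 / 4 <= T - v <= 2.
  apply/andP; split; first by rewrite /T /v; clear -s0 s1 lu2 lu1 lm1; lra.
  have lm2 : l / m <= 3.
    by rewrite ler_pdivrMr /m; clear -hl1 hl2; lra.
  by rewrite /T /v; clear -s0 s1 lu2 lu1 lm2; lra.
have g02 : 1 / 4 <= g <= 1 by rewrite /g; clear -u0 u2; lra.
have le_d0d : (d0 <= d)%N by rewrite /d mul2n -addnn; apply: leq_trans (leqnSn _) (leq_addr _ _).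
have [k [C [hC hcount]]] := hd0 d le_d0d T (T - f) (T - v) g T02 F02 V02 g02 core.
pose p := 2 * (T - f); pose q := 3 * (T - v); pose r := d%:R * (T - C).
have p0 : 0 < p by rewrite /p; clear -F02; lra.
have q0 : 0 < q by rewrite /q; clear -V02; lra.
have hlow := card_low_lt_halfplane p0 q0 hcount.
pose E := halfplane d p q r.
have sE : E \subset Tset d by apply/fintype.subsetP => t; rewrite inE => /andP[].
have E0 : E != finset.set0 by rewrite -card_gt0; apply: leq_ltn_trans hlow.
exists E; split=> //; apply/eqP; apply: contraT => ne0.
(* Every monomial of E has a logarithm at most C d A' - M, whereas k (A' - B) is
   at least C d A'. *)
suff hp t : t \in E ->
     `|formT (real_pt R x) (real_pt R y)| ^+ (d - 2 * t.1 - 3 * t.2)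
     * `|formF (real_pt R x) (real_pt R y)| ^+ t.1
     * `|formW (real_pt R x) (real_pt R y)| ^+ t.2 <= expR (C * d%:R * A' - M).
  have hk := lowset_lt_le sE hlow.
  have hup := hK E k E0 sE hlow x z a b b0 ne0 _ hp.
  have hgk : expR (C * d%:R * A') <= expR (A' - B) ^+ k.
    rewrite -expRM_natr ler_expR BE.
    have := ler_wpM2r (ltW A'0) hC; rewrite /g; clear; lra.
  have := small k hk; rewrite ltNge => /negP[].
  rewrite -(ler_pM2r (expR_gt0 (C * d%:R * A'))) -[leRHS]mulrA -expRD (addrC (- M)).
  apply: le_trans hup => //.
  apply: le_trans (_ : (1 / 3) ^+ k * expR (A' - B) ^+ k <= _).
    by rewrite ler_wpM2l // exprn_ge0 // divr_ge0.
  rewrite -exprMn; apply: lerXn2r; rewrite ?nnegrE.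
  - by rewrite mulr_ge0 ?expR_ge0 // divr_ge0.
  - by rewrite ler0z.
  - by move: hb; rewrite mulrC mul1r.
rewrite !inE => /andP[ht hr].
set w := (d - 2 * t.1 - 3 * t.2)%N.
have dE : d%:R = w%:R + 2 * (t.1 : nat)%:R + 3 * (t.2 : nat)%:R :> R.
  by rewrite -!natrM -!natrD /w weight_split.
have wmn : 1 <= w%:R + (t.1 : nat)%:R + (t.2 : nat)%:R :> R.
  rewrite -!natrD ler1n.
  exact: weight_split_gt0.
have hT' : `|formT (real_pt R x) (real_pt R y)| <= expR (T * A' - M).
  apply: le_trans hT _; rewrite ler_expR lerD2r BE /T; move: As; clear; lra.
have hF' : `|formF (real_pt R x) (real_pt R y)| <= expR (2 * f * A' - M).
  apply: le_trans hF _; rewrite ler_expR lerD2r ge_max /f; apply/andP; split.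
    apply: le_trans hF1 _; rewrite !mulr_ge0 ?(ltW A'0) //; clear -lu1; lra.
  rewrite BE; clear; lra.
have hW' : `|formW (real_pt R x) (real_pt R y)| <= expR (3 * v * A' - M).
  apply: le_trans hW _; rewrite ler_expR lerD2r.
  have hB' : l / m * A' <= l * (B + B').
    have m0 : 0 < m by rewrite /m; clear -hl2; lra.
    rewrite mulrAC ler_pdivrMr // -mulrA ler_wpM2l //; first by clear -hl1; lra.
    by rewrite mulrC.
  have -> : 3 * v * A' = 4 * (s * A') + 2 * A' - l / m * A' - l * (u * A').
    by rewrite /v; field; rewrite /m; clear -hl2; apply/eqP; lra.
  rewrite -BE; move: As hB'; clear; lra.
have key n (h X : R) : 0 <= h -> h <= expR X -> h ^+ n <= expR (n%:R * X).
  by move=> h0 hX; rewrite expRM_natl lerXn2r ?nnegrE ?expR_ge0.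
apply: le_trans (_ : expR (w%:R * (T * A' - M)) * expR ((t.1 : nat)%:R * (2 * f * A' - M))
    * expR ((t.2 : nat)%:R * (3 * v * A' - M)) <= _).
  by apply: ler_pM; rewrite ?mulr_ge0 ?exprn_ge0 //; [apply: ler_pM; rewrite ?exprn_ge0 //|]; exact: key.
rewrite -!expRD ler_expR.
have hr' : (w%:R * T + (t.1 : nat)%:R * (2 * f) + (t.2 : nat)%:R * (3 * v)) * A'
    <= C * d%:R * A'.
  rewrite ler_wpM2r ?(ltW A'0) //; move: hr; rewrite /r /p /q dE; clear; lra.
have hM' : M <= (w%:R + (t.1 : nat)%:R + (t.2 : nat)%:R) * M by rewrite ler_peMl.
move: hr' hM'; clear; lra.
Qed.
End Pair.

(** * Minimal points *)

Lemma row3P (T : Type) (u v : 'rV[T]_3) :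
  u 0 c0 = v 0 c0 -> u 0 c1 = v 0 c1 -> u 0 c2 = v 0 c2 -> u = v.
Proof.
move=> h0 h1 h2; apply/rowP => -[[|[|[|//]]] hj].
- by rewrite (_ : Ordinal hj = c0) //; apply: val_inj.
- by rewrite (_ : Ordinal hj = c1) //; apply: val_inj.
- by rewrite (_ : Ordinal hj = c2) //; apply: val_inj.
Qed.

Section Seminorms.
Variables (R : realType) (xi : R).
Implicit Types u v w : 'rV[R]_3.

Lemma supnormP u B : reflect [/\ `|u 0 c0| <= B, `|u 0 c1| <= B & `|u 0 c2| <= B]
  (supnorm u <= B).
Proof.
rewrite /supnorm !ge_max -andbA; exact: and3P.
Qed.

Lemma LdistP u B : reflect (`|u 0 c1 - u 0 c0 * xi| <= B
  /\ `|u 0 c2 - u 0 c0 * xi ^+ 3| <= B) (Ldist xi u <= B).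
Proof. rewrite /Ldist ge_max; exact: andP. Qed.

Lemma supnorm_comb a b u v :
  supnorm (a *: u + b *: v) <= `|a| * supnorm u + `|b| * supnorm v.
Proof.
have /supnormP[u0 u1 u2] := lexx (supnorm u).
have /supnormP[v0 v1 v2] := lexx (supnorm v).
apply/supnormP; rewrite !mxE.
by split; apply: le_trans (ler_normD _ _) _; rewrite !normrM lerD // ler_wpM2l.
Qed.

Lemma Ldist_comb a b u v :
  Ldist xi (a *: u + b *: v) <= `|a| * Ldist xi u + `|b| * Ldist xi v.
Proof.
have /LdistP[u1 u2] := lexx (Ldist xi u).
have /LdistP[v1 v2] := lexx (Ldist xi v).
apply/LdistP; rewrite !mxE; split.
  rewrite (_ : _ - _ = a * (u 0 c1 - u 0 c0 * xi) + b * (v 0 c1 - v 0 c0 * xi)); last ring.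
  by apply: le_trans (ler_normD _ _) _; rewrite !normrM lerD // ler_wpM2l.
rewrite (_ : _ - _ = a * (u 0 c2 - u 0 c0 * xi ^+ 3) + b * (v 0 c2 - v 0 c0 * xi ^+ 3)); last ring.
by apply: le_trans (ler_normD _ _) _; rewrite !normrM lerD // ler_wpM2l.
Qed.

Lemma supnorm_ge0 u : 0 <= supnorm u.
Proof. by rewrite /supnorm !le_max normr_ge0. Qed.
Lemma Ldist_ge0 u : 0 <= Ldist xi u.
Proof. by rewrite /Ldist !le_max normr_ge0. Qed.

Lemma supnormZ a u : supnorm (a *: u) = `|a| * supnorm u.
Proof. by rewrite /supnorm !mxE !normrM !maxr_pMr ?normr_ge0. Qed.
Lemma LdistZ a u : Ldist xi (a *: u) = `|a| * Ldist xi u.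
Proof.
rewrite /Ldist !mxE -!mulrA -!mulrBr !normrM maxr_pMr ?normr_ge0 //.
Qed.
End Seminorms.

Section IntegerPoints.
Variables (R : realType) (xi : R).
Implicit Types y z : 'rV[int]_3.

Definition ht y : R := supnorm (toR R y).
Definition dist y : R := Ldist xi (toR R y).

Lemma toR_comb (a b : int) y z :
  toR R (a *: y + b *: z) = a%:~R *: toR R y + b%:~R *: toR R z.
Proof. by apply/rowP => j; rewrite !mxE rmorphD !rmorphM. Qed.

Lemma toR_inj : injective (toR R).
Proof.
move=> y z h; apply/rowP => j; have := congr1 (fun u : 'rV[R]_3 => u 0 j) h.
by rewrite !mxE => /intr_inj.
Qed.

Lemma ht_int y : exists n : nat, ht y = n%:R.
Proof.
exists (maxn (maxn `|(y 0 c0 : int)%R| `|(y 0 c1)%R|) `|(y 0 c2)%R|)%N.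
rewrite /ht /supnorm !mxE -!intr_norm.
have e (m n : nat) : (maxn m n)%:R = Num.max m%:R n%:R :> R.
  by rewrite /Num.max ltr_nat /maxn; case: ltnP.
by rewrite !e -!natr_absz !pmulrn.
Qed.

Lemma ht_ge1 y : y != 0 -> 1 <= ht y.
Proof.
move=> y0; have [n hn] := ht_int y; rewrite hn ler1n lt0n.
apply: contraNneq y0 => n0; apply/eqP/toR_inj.
have /supnormP[h0 h1 h2] : ht y <= 0 by rewrite hn n0.
apply: row3P; rewrite !mxE; apply/eqP.
- by move: h0; rewrite mxE normr_le0.
- by move: h1; rewrite mxE normr_le0.
- by move: h2; rewrite mxE normr_le0.
Qed.
End IntegerPoints.

Section Minimal.
Variables (R : realType) (xi : R) (x : nat -> 'rV[int]_3).
Hypothesis hx : minimal_points xi x.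
Notation X i := (ht R (x i)).
Notation L i := (dist xi (x i)).

Lemma min_neq0 i : (1 <= i)%N -> x i != 0.
Proof. by case: hx => h _ _ _; apply: h. Qed.
Lemma ht_lt i : (1 <= i)%N -> X i < X i.+1.
Proof. by case: hx => _ h _ _; apply: h. Qed.
Lemma dist_lt i : (1 <= i)%N -> L i.+1 < L i.
Proof. by case: hx => _ _ [_ h] _; apply: h. Qed.
Lemma minimal_ht_lower y i : (1 <= i)%N -> y != 0 -> dist xi y < L i -> X i.+1 <= ht R y.
Proof. by case: hx => _ _ _ h; apply: h. Qed.

Lemma ht_le i j : (1 <= i <= j)%N -> X i <= X j.
Proof.
move=> /andP[i1]; elim: j => [|j IH]; first by rewrite leqn0 => /eqP i0; rewrite i0 in i1.
rewrite leq_eqVlt => /orP[/eqP ->//|]; rewrite ltnS => ij.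
by apply: le_trans (IH ij) (ltW (ht_lt _)); apply: leq_trans ij.
Qed.
Lemma ht_lt_trans i j : (1 <= i < j)%N -> X i < X j.
Proof.
by move=> /andP[i1 ij]; apply: lt_le_trans (ht_lt i1) _; apply: ht_le.
Qed.
Lemma dist_le i j : (1 <= i <= j)%N -> L j <= L i.
Proof.
move=> /andP[i1]; elim: j => [|j IH]; first by rewrite leqn0 => /eqP i0; rewrite i0 in i1.
rewrite leq_eqVlt => /orP[/eqP ->//|]; rewrite ltnS => ij.
by apply: le_trans (ltW (dist_lt _)) (IH ij); apply: leq_trans ij.
Qed.
Lemma dist_gt0 i : (1 <= i)%N -> 0 < L i.
Proof. by move=> i1; apply: le_lt_trans (dist_lt i1); exact: Ldist_ge0. Qed.
Lemma dist_lt_half i : (1 <= i)%N -> L i < 1 / 2.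
Proof.
move=> i1; apply: le_lt_trans (dist_le (i := 1) _) _; first by rewrite i1.
by case: hx => _ _ [].
Qed.

Lemma ht_ge i : (1 <= i)%N -> i%:R <= X i.
Proof.
elim: i => // -[|i] IH _; first exact: ht_ge1 (min_neq0 _).
have := IH isT; have := ht_lt (i := i.+1) isT.
have [m hm] := ht_int R (x i.+1); have [n hn] := ht_int R (x i.+2).
by rewrite hm hn ltr_nat !ler_nat => h1 h2; apply: leq_ltn_trans h2 h1.
Qed.

(** The factor would be at least 1 in absolute value by the norms, and less than
    1 by the distances. *)
Lemma consecutive_not_proportional i (r : R) : (1 <= i)%N -> toR R (x i.+1) != r *: toR R (x i).
Proof.
move=> i1; apply/negP => /eqP h.
have hX : X i.+1 = `|r| * X i by rewrite /ht h supnormZ.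
have hL : L i.+1 = `|r| * L i by rewrite /dist h LdistZ.
have r1 : `|r| < 1.
  have := dist_lt i1; rewrite hL -[ltRHS]mul1r ltr_pM2r //; exact: dist_gt0.
have := ht_lt i1; rewrite hX ltNge => /negP; apply.
by rewrite -[leRHS]mul1r ler_wpM2r ?(ltW r1) //; exact: supnorm_ge0.
Qed.

(** Reduce the real coefficients modulo 1 to [-1/2, 1/2]: the remaining integer
    point is closer than x_i and of smaller norm than x_{i+1}, so it is 0. *)
Lemma lattice_basis i (y : 'rV[int]_3) (al be : R) : (1 <= i)%N ->
  toR R y = al *: toR R (x i) + be *: toR R (x i.+1) ->
  exists a b : int, y = a *: x i + b *: x i.+1.
Proof.
move=> i1 hy.
have round (r : R) : exists n : int, `|r - n%:~R| <= 1 / 2.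
  exists (Num.floor (r + 1 / 2)).
  have := Num.Theory.real_floor_le (num_real (r + 1 / 2)).
  have := Num.Theory.real_floorD1_gt (num_real (r + 1 / 2)).
  rewrite intrD; move: ((Num.floor _)%:~R) => f h1 h2.
  by rewrite ler_norml; lra.
have [a ha] := round al; have [b hb] := round be.
exists a, b; apply/eqP; rewrite -subr_eq0; apply: contraT => z0.
set z := y - _ in z0.
have hz : toR R z = (al - a%:~R) *: toR R (x i) + (be - b%:~R) *: toR R (x i.+1).
  have -> : toR R z = toR R y - toR R (a *: x i + b *: x i.+1).
    by apply/rowP => j; rewrite !mxE rmorphB.
  by rewrite hy toR_comb !scalerBl; apply/rowP => j; rewrite !mxE; ring.
have L0 := dist_gt0 i1; have Ll := dist_lt i1; have Xl := ht_lt i1.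
have L0' := dist_gt0 (i := i.+1) isT.
have X0 : 0 <= X i by exact: supnorm_ge0.
have X0' : 0 <= X i.+1 by exact: supnorm_ge0.
have hd : dist xi z < L i.
  rewrite /dist hz; apply: le_lt_trans (Ldist_comb _ _ _ _ _) _.
  rewrite -/(L i) -/(L i.+1).
  apply: le_lt_trans (lerD (ler_wpM2r (ltW L0) ha) (ler_wpM2r (ltW L0') hb)) _.
  clear -Ll; lra.
have := minimal_ht_lower i1 z0 hd; rewrite leNgt => /negP; case.
rewrite /ht hz; apply: le_lt_trans (supnorm_comb _ _ _ _) _.
rewrite -/(X i) -/(X i.+1).
apply: le_lt_trans (lerD (ler_wpM2r X0 ha) (ler_wpM2r X0' hb)) _.
clear -Xl; lra.
Qed.

Lemma notI_lattice k : (2 <= k)%N -> ~ indexI R x k ->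
  exists a b : int, x k.+1 = a *: x k.-1 + b *: x k.
Proof.
case: k => // k; rewrite ltnS => k1 hI; rewrite /=.
have : ~~ free [:: toR R (x k); toR R (x k.+1); toR R (x k.+2)].
  by apply/negP => hf; apply: hI; split.
rewrite (@perm_free _ _ _ [:: toR R (x k.+2); toR R (x k.+1); toR R (x k)]); last first.
  by rewrite perm_sym (perm_rev [:: toR R (x k); toR R (x k.+1); toR R (x k.+2)]).
rewrite !free_cons nil_free andbT span_seq1 span_cons span_seq1 span_nil memv0.
rewrite !negb_and !negbK => /or3P[|/vlineP[r hr]|/eqP h0].
- case/memv_addP => u /vlineP[be ->] [v /vlineP[al ->] h].
  by apply: (lattice_basis (al := al) (be := be)) => //; rewrite addrC.
- by have := consecutive_not_proportional r k1; rewrite hr eqxx.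
- have := min_neq0 k1; rewrite -(inj_eq (@toR_inj R)) h0.
  by rewrite (_ : toR R 0 = 0) ?eqxx //; apply/rowP => j; rewrite !mxE.
Qed.

Lemma span_from m n : (1 <= m <= n)%N ->
  (forall k, (m < k < n)%N -> ~ indexI R x k) ->
  exists a b : int, x n = a *: x m + b *: x m.+1.
Proof.
move=> /andP[m1 mn] hI.
elim/ltn_ind: n mn hI => n IH mn hI.
have [nm|mn'] := leqP n m.
  have -> : n = m by apply/eqP; rewrite eqn_leq nm mn.
  by exists 1, 0; rewrite scale1r scale0r addr0.
have [nm|mn2] := leqP n m.+1.
  have -> : n = m.+1 by apply/eqP; rewrite eqn_leq nm mn'.
  by exists 0, 1; rewrite scale1r scale0r add0r.
case: n IH mn hI mn' mn2 => // -[//|n] IH mn hI mn' mn2.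
have [a [b hab]] : exists a b : int, x n.+2 = a *: x n + b *: x n.+1.
  apply: (@notI_lattice n.+1); first by rewrite ltnS; apply: leq_trans m1 _; rewrite -2!ltnS.
  by apply: hI; rewrite -ltnS mn2 /=.
have [a1 [b1 h1]] : exists a b : int, x n = a *: x m + b *: x m.+1.
  by apply: IH => // k /andP[k1 k2]; apply: hI; rewrite k1 ltnW // ltnW.
have [a2 [b2 h2]] : exists a b : int, x n.+1 = a *: x m + b *: x m.+1.
  by apply: IH => // k /andP[k1 k2]; apply: hI; rewrite k1 ltnW.
exists (a * a1 + b * a2), (a * b1 + b * b2).
rewrite hab h1 h2 !scalerDr !scalerDl !scalerA; rewrite addrACA. by [].
Qed.

(** Comparing distances in a x_i = x_j - b x_{i+1} gives |a| <= 1 + |b|; then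
    compare norms. *)
Lemma coef_bound i j (a b : int) : (1 <= i < j)%N ->
  x j = a *: x i + b *: x i.+1 -> b != 0 /\ X j <= 3 * `|b|%:~R * X i.+1.
Proof.
move=> /andP[i1 ij] hj.
have L0 := dist_gt0 i1.
have hL : L j <= L i by apply: dist_le; rewrite i1 ltnW.
have X1 : 0 <= X i by exact: supnorm_ge0.
have XX := ht_lt i1.
have ha : `|a|%:~R <= 1 + `|b|%:~R :> R.
  rewrite -(ler_pM2r L0) mulrDl mul1r.
  have -> : `|a|%:~R * L i = Ldist xi (1 *: toR R (x j) + (- b)%:~R *: toR R (x i.+1)).
    rewrite hj toR_comb rmorphN scaleNr scale1r addrK LdistZ -intr_norm. by [].
  apply: le_trans (Ldist_comb _ _ _ _ _) _; rewrite normr1 mul1r -intr_norm normrN.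
  by rewrite lerD // ler_wpM2l ?ler0z // ltW // dist_lt.
have hXj : X j <= X i + 2 * `|b|%:~R * X i.+1.
  rewrite /ht hj toR_comb; apply: le_trans (supnorm_comb _ _ _ _) _.
  rewrite -!intr_norm -/(X i) -/(X i.+1).
  have b0 : 0 <= `|b|%:~R :> R by rewrite ler0z.
  have := ler_wpM2r X1 ha; have := ler_wpM2l b0 (ltW XX); clear; lra.
have XL : X i < X j by apply: ht_lt_trans; rewrite i1.
have b0 : b != 0.
  apply: contraTneq hXj => ->; rewrite normr0 mulr0 mul0r addr0 -ltNge //.
split=> //.
have b1 : 1 <= `|b|%:~R :> R by rewrite ler1z -gtz0_ge1 normr_gt0.
have : 1 * X i.+1 <= `|b|%:~R * X i.+1.
  by rewrite ler_wpM2r //; exact: supnorm_ge0.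
move: XX hXj; clear; lra.
Qed.
End Minimal.

(** * Cross products and determinants *)

Section Cross.
Variables (R : realType) (xi : R).
Implicit Types u v w y z : 'rV[int]_3.

Definition cr01 y z : int := y 0 c0 * z 0 c1 - y 0 c1 * z 0 c0.
Definition cr02 y z : int := y 0 c0 * z 0 c2 - y 0 c2 * z 0 c0.
Definition cr12 y z : int := y 0 c1 * z 0 c2 - y 0 c2 * z 0 c1.
Definition det3 y z w : int :=
  cr12 y z * w 0 c0 - cr02 y z * w 0 c1 + cr01 y z * w 0 c2.

(** The cross product of consecutive minimal points is at most this constant
    times X_{i+1} L_i. *)
Definition cross_const : R := 2 + `|xi| + `|xi| ^+ 3.

Lemma cross_const_ge2 : 2 <= cross_const.
Proof. by rewrite /cross_const -addrA lerDl addr_ge0 // exprn_ge0. Qed.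

Lemma ht_coord y : [/\ `|(y 0 c0)%:~R| <= ht R y, `|(y 0 c1)%:~R| <= ht R y
   & `|(y 0 c2)%:~R| <= ht R y].
Proof. by have /supnormP := lexx (ht R y); rewrite !mxE. Qed.

Lemma dist_coord y : `|(y 0 c1)%:~R - (y 0 c0)%:~R * xi| <= dist xi y
  /\ `|(y 0 c2)%:~R - (y 0 c0)%:~R * xi ^+ 3| <= dist xi y.
Proof. by have /LdistP := lexx (dist xi y); rewrite !mxE. Qed.

Lemma ht_le_coord0 y : ht R y <= (cross_const - 1) * `|(y 0 c0)%:~R| + dist xi y.
Proof.
have [d1 d2] := dist_coord y.
have d0 : 0 <= dist xi y by exact: Ldist_ge0.
have h0 : 0 <= `|(y 0 c0)%:~R| :> R by [].
have hx0 : 0 <= `|xi| by [].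
have hx3 : 0 <= `|xi| ^+ 3 by rewrite exprn_ge0.
have p1 := mulr_ge0 hx0 h0; have p3 := mulr_ge0 hx3 h0.
apply/supnormP; rewrite !mxE /cross_const; split.
- move: p1 p3 d0; clear; lra.
- have := ler_normD ((y 0 c1)%:~R - (y 0 c0)%:~R * xi) ((y 0 c0)%:~R * xi).
  rewrite subrK normrM; move: d1 p1 p3 h0; clear; lra.
- have := ler_normD ((y 0 c2)%:~R - (y 0 c0)%:~R * xi ^+ 3) ((y 0 c0)%:~R * xi ^+ 3).
  rewrite subrK normrM normrX; move: d2 p1 p3 h0; clear; lra.
Qed.

Lemma norm_mul_le (a b A B : R) : `|a| <= A -> `|b| <= B -> `|a * b| <= A * B.
Proof. by move=> ha hb; rewrite normrM ler_pM. Qed.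

Lemma norm_sub_le (a b A B : R) : `|a| <= A -> `|b| <= B -> `|a - b| <= A + B.
Proof. by move=> ha hb; apply: le_trans (ler_normB _ _) _; rewrite lerD. Qed.

Lemma norm_add_le (a b A B : R) : `|a| <= A -> `|b| <= B -> `|a + b| <= A + B.
Proof. by move=> ha hb; apply: le_trans (ler_normD _ _) _; rewrite lerD. Qed.

(** Every component is a combination of products of a coordinate of one point
    and a deviation of the other from the line of (1, xi, xi^3). *)
Lemma cross_bound y z : ht R y <= ht R z -> dist xi z <= dist xi y ->
  [/\ `|(cr01 y z)%:~R| <= cross_const * (ht R z * dist xi y),
      `|(cr02 y z)%:~R| <= cross_const * (ht R z * dist xi y)
    & `|(cr12 y z)%:~R| <= cross_const * (ht R z * dist xi y)].
Proof.
move=> hX hL.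
have [y0 y1 y2] := ht_coord y; have [z0 z1 z2] := ht_coord z.
have [d1 d2] := dist_coord y; have [e1 e2] := dist_coord z.
have X0 : 0 <= ht R y by exact: supnorm_ge0.
have L0 : 0 <= dist xi z by exact: Ldist_ge0.
have p : ht R y * dist xi z <= ht R z * dist xi y by rewrite ler_pM.
have q0 : 0 <= ht R z * dist xi y.
  by apply: le_trans p; rewrite mulr_ge0.
have hx0 : 0 <= `|xi| by []. have hx3 : 0 <= `|xi| ^+ 3 by rewrite exprn_ge0.
have q1 := mulr_ge0 hx0 q0; have q3 := mulr_ge0 hx3 q0.
rewrite /cross_const /cr01 /cr02 /cr12 !rmorphB !rmorphM /=.
move: (y 0 c0)%:~R (y 0 c1)%:~R (y 0 c2)%:~R (z 0 c0)%:~R (z 0 c1)%:~R (z 0 c2)%:~R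
  y0 y1 y2 z0 z1 z2 d1 d2 e1 e2 => a0 a1 a2 b0 b1 b2 y0 y1 y2 z0 z1 z2 d1 d2 e1 e2.
split.
- have -> : a0 * b1 - a1 * b0 = a0 * (b1 - b0 * xi) - b0 * (a1 - a0 * xi) by ring.
  have := norm_sub_le (norm_mul_le y0 e1) (norm_mul_le z0 d1).
  move: p q1 q3; clear; lra.
- have -> : a0 * b2 - a2 * b0 = a0 * (b2 - b0 * xi ^+ 3) - b0 * (a2 - a0 * xi ^+ 3) by ring.
  have := norm_sub_le (norm_mul_le y0 e2) (norm_mul_le z0 d2).
  move: p q1 q3; clear; lra.
have -> : a1 * b2 - a2 * b1 = (a1 * (b2 - b0 * xi ^+ 3) - a2 * (b1 - b0 * xi))
   + b0 * (xi ^+ 3 * (a1 - a0 * xi) - xi * (a2 - a0 * xi ^+ 3)) by ring.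
have n3 : `|xi ^+ 3| <= `|xi| ^+ 3 by rewrite normrX.
have := norm_add_le (norm_sub_le (norm_mul_le y1 e2) (norm_mul_le y2 e1))
  (norm_mul_le z0 (norm_sub_le (norm_mul_le n3 d1) (norm_mul_le (lexx `|xi|) d2))).
move: p q1 q3; clear; lra.
Qed.

Lemma cross0_prop y z : y != 0 -> cr01 y z = 0 -> cr02 y z = 0 -> cr12 y z = 0 ->
  exists r : R, toR R z = r *: toR R y.
Proof.
move=> y0; rewrite /cr01 /cr02 /cr12.
move=> /(congr1 (intr : int -> R)); rewrite !rmorphB !rmorphM mulr0z /= => h01.
move=> /(congr1 (intr : int -> R)); rewrite !rmorphB !rmorphM mulr0z /= => h02.
move=> /(congr1 (intr : int -> R)); rewrite !rmorphB !rmorphM mulr0z /= => h12.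
have solve (a b p q : R) : p != 0 -> p * b - a * q = 0 -> b = q / p * a.
  move=> p0 /subr0_eq h; apply: (mulfI p0); rewrite h; field. exact: p0.
have [n0|n0] := eqVneq (y 0 c0) 0; last first.
  have n0R : (y 0 c0)%:~R != 0 :> R by rewrite intr_eq0.
  exists ((z 0 c0)%:~R / (y 0 c0)%:~R); apply: row3P; rewrite !mxE.
  - by rewrite divfK.
  - exact: solve h01.
  - exact: solve h02.
have [n1|n1] := eqVneq (y 0 c1) 0; last first.
  have n1R : (y 0 c1)%:~R != 0 :> R by rewrite intr_eq0.
  exists ((z 0 c1)%:~R / (y 0 c1)%:~R); apply: row3P; rewrite !mxE.
  - by apply: solve => //; rewrite -[RHS]oppr0 -h01; ring.
  - by rewrite divfK.
  - exact: solve h12.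
have [n2|n2] := eqVneq (y 0 c2) 0.
  by case/eqP: y0; apply: row3P; rewrite mxE.
have n2R : (y 0 c2)%:~R != 0 :> R by rewrite intr_eq0.
exists ((z 0 c2)%:~R / (y 0 c2)%:~R); apply: row3P; rewrite !mxE.
- by apply: solve => //; rewrite -[RHS]oppr0 -h02; ring.
- by apply: solve => //; rewrite -[RHS]oppr0 -h12; ring.
- by rewrite divfK.
Qed.
End Cross.

Section Det.
Variables (R : realType) (xi : R).
Implicit Types u v w y z : 'rV[int]_3.
Local Notation kap := (cross_const xi).

(** The relation between u, v, w given by the first two coordinates of the three
    points, and likewise for the other pairs of coordinates; it holds in the
    remaining coordinate because the determinant is 0. *)
Lemma det3_relations u v w : det3 u v w = 0 ->
  [/\ cr01 u v *: w = - cr01 v w *: u + cr01 u w *: v,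
      cr02 u v *: w = - cr02 v w *: u + cr02 u w *: v
    & cr12 u v *: w = - cr12 v w *: u + cr12 u w *: v].
Proof.
move=> hd; split; apply: row3P; rewrite !mxE;
  apply/eqP; rewrite -subr_eq0; apply/eqP; move: hd;
  rewrite /det3 /cr01 /cr02 /cr12;
  move: (u 0 c0) (u 0 c1) (u 0 c2) (v 0 c0) (v 0 c1) (v 0 c2)
    (w 0 c0) (w 0 c1) (w 0 c2) => u0 u1 u2 v0 v1 v2 w0 w1 w2 hd;
  by [ring | rewrite -[RHS]hd; ring | rewrite -[RHS]oppr0 -hd; ring].
Qed.

(** If all three coefficients cr of w in [det3_relations] vanish, then v is
    proportional to u; otherwise w lies in the span of u and v. *)
Lemma free_det3 u v w : free [:: toR R u; toR R v; toR R w] -> det3 u v w != 0.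
Proof.
rewrite (@perm_free _ _ _ [:: toR R w; toR R v; toR R u]); last first.
  by rewrite perm_sym (perm_rev [:: toR R u; toR R v; toR R w]).
rewrite !free_cons nil_free andbT span_seq1 span_cons span_seq1 span_nil memv0.
case/and3P => wuv vu u0; apply/negP => /eqP /det3_relations[h01 h02 h12].
have dep (p al be : int) : p *: w = al *: u + be *: v -> p = 0.
  move=> h; apply/eqP; apply: contraNT wuv => p0.
  have pR : p%:~R != 0 :> R by rewrite intr_eq0.
  have -> : toR R w = (p%:~R^-1 * al%:~R) *: toR R u + (p%:~R^-1 * be%:~R) *: toR R v.
    have := congr1 (toR R) h; rewrite toR_comb => h'.
    rewrite -!scalerA -scalerDr -h'; apply/rowP => j; rewrite !mxE rmorphM.
    by rewrite mulKf.
  by rewrite addrC; apply: memv_add; apply: memvZ; exact: memv_line.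
have u0' : u != 0.
  apply: contraNneq u0 => ->; apply/eqP/rowP => j; by rewrite !mxE.
have [r hr] := cross0_prop R u0' (dep _ _ _ h01) (dep _ _ _ h02) (dep _ _ _ h12).
by case/negP: vu; apply/vlineP; exists r.
Qed.
End Det.

(** * Heights of the planes of consecutive minimal points *)

Section Heights.
Variables (R : realType) (xi : R) (x : nat -> 'rV[int]_3).
Hypothesis hx : minimal_points xi x.
Notation X i := (ht R (x i)).
Notation L i := (dist xi (x i)).
Local Notation kap := (cross_const xi).

Lemma cross_consecutive i : (1 <= i)%N ->
  [/\ `|(cr01 (x i) (x i.+1))%:~R| <= kap * (X i.+1 * L i),
      `|(cr02 (x i) (x i.+1))%:~R| <= kap * (X i.+1 * L i)
    & `|(cr12 (x i) (x i.+1))%:~R| <= kap * (X i.+1 * L i)].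
Proof.
by move=> i1; apply: cross_bound; apply/ltW; [exact: (ht_lt hx)|exact: (dist_lt hx)].
Qed.

Lemma cross_neq0 i : (1 <= i)%N -> cr01 (x i) (x i.+1) = 0 ->
  cr02 (x i) (x i.+1) = 0 -> cr12 (x i) (x i.+1) = 0 -> False.
Proof.
move=> i1 h01 h02 h12; have xi0 := min_neq0 hx i1.
have [r hr] := cross0_prop R xi0 h01 h02 h12.
by have := consecutive_not_proportional hx r i1; rewrite hr eqxx.
Qed.

Lemma consecutive_span i j : consecutive (indexI R x) i j ->
  [/\ (1 <= i)%N, (i < j)%N,
      exists a b : int, x j.-1 = a *: x i + b *: x i.+1
    & exists a b : int, x j = a *: x i + b *: x i.+1].
Proof.
case=> [[i2 _] _ ij hI]; have i1 : (1 <= i)%N by apply: leq_trans i2.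
split=> //; apply: (span_from hx).
- by rewrite i1 -ltnS (ltn_predK ij).
- move=> k /andP[k1 k2] /hI; rewrite k1 /=; apply/negP; rewrite negbK.
  by apply: leq_trans k2 _; exact: leq_pred.
- by rewrite i1 ltnW.
- by move=> k /andP[k1 k2] /hI; rewrite k1 k2.
Qed.

(** With n = x_i x x_{i+1} and n' = x_j x x_{j+1} (cross products), n x n' is the
    product of x_j by det(x_i, x_{i+1}, x_{j+1}), a non-zero integer. *)
Lemma height_inequality i j : consecutive (indexI R x) i j ->
  X j <= 2 * kap ^+ 2 * (X i.+1 * L i) * (X j.+1 * L j).
Proof.
move=> hij; have [i1 ij [a' [b' h']] [a [b h]]] := consecutive_span hij.
have [_ [_ hfree] _ _] := hij.
have j1 : (1 <= j)%N by apply: leq_trans ij.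
set u := x i; set v := x i.+1; set w := x j; set z := x j.+1.
have hD : det3 u v z != 0.
  have := free_det3 hfree; rewrite h h' -/u -/v -/z; apply: contraNneq => h0.
  have -> : det3 (a' *: u + b' *: v) (a *: u + b *: v) z = (a' * b - b' * a) * det3 u v z.
    rewrite /det3 /cr01 /cr02 /cr12 !mxE.
    move: (u 0 c0) (u 0 c1) (u 0 c2) (v 0 c0) (v 0 c1) (v 0 c2) (z 0 c0) (z 0 c1) (z 0 c2).
    by move=> *; ring.
  by rewrite h0 mulr0.
have hW : det3 u v w = 0.
  rewrite /w h -/u -/v /det3 /cr01 /cr02 /cr12 !mxE.
  move: (u 0 c0) (u 0 c1) (u 0 c2) (v 0 c0) (v 0 c1) (v 0 c2) => *; ring.
have [n01 n02 n12] := cross_consecutive i1.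
have [m01 m02 m12] := cross_consecutive j1.
rewrite -/u -/v in n01 n02 n12; rewrite -/w -/z in m01 m02 m12.
(* Each coordinate t of x_j, times the determinant, is a 2 by 2 minor of the
   two cross products. *)
have key (t p q r s : int) : `|p%:~R| <= kap * (X i.+1 * L i) ->
    `|q%:~R| <= kap * (X j.+1 * L j) -> `|r%:~R| <= kap * (X i.+1 * L i) ->
    `|s%:~R| <= kap * (X j.+1 * L j) -> det3 u v z * t = p * q - r * s ->
    `|t%:~R| <= 2 * kap ^+ 2 * (X i.+1 * L i) * (X j.+1 * L j).
  move=> hp hq hr hs ht.
  apply: le_trans (_ : `|(det3 u v z * t)%:~R| <= _).
    rewrite -!intr_norm normrM ler_int ler_peMl // -gtz0_ge1 normr_gt0 //.
  rewrite ht rmorphB !rmorphM.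
  apply: le_trans (norm_sub_le (norm_mul_le hp hq) (norm_mul_le hr hs)) _.
  by rewrite le_eqVlt; apply/orP; left; apply/eqP; ring.
have E (k : 'I_3) : det3 u v z * w 0 k = det3 u v z * w 0 k - det3 u v w * z 0 k.
  by rewrite hW mul0r subr0.
rewrite -/w; apply/supnormP; rewrite !mxE; split.
- apply: (key _ _ _ _ _ n01 m02 n02 m01); rewrite E.
  rewrite /det3 /cr01 /cr02 /cr12; ring.
- apply: (key _ _ _ _ _ n01 m12 n12 m01); rewrite E.
  rewrite /det3 /cr01 /cr02 /cr12; ring.
- apply: (key _ _ _ _ _ n02 m12 n12 m02); rewrite E.
  rewrite /det3 /cr01 /cr02 /cr12; ring.
Qed.

(** Otherwise all x_n from some point on lie in one rational plane.  Its normal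
    vector is then orthogonal to the limit direction (1, xi, xi^3). *)
Lemma indexI_unbounded : lin_indep_Q_1_xi_xi3 xi ->
  forall m, exists2 i, (m <= i)%N & indexI R x i.
Proof.
move=> hxi m0; apply: boolp.contrapT => hno.
pose m := m0.+1.
have span n : (m <= n)%N -> exists a b : int, x n = a *: x m + b *: x m.+1.
  move=> mn; apply: (span_from hx); first by rewrite mn.
  move=> k /andP[k1 _] hk; apply: hno; exists k => //; apply: ltnW; exact: ltnW k1.
set u := x m in span; set v := x m.+1 in span.
pose n0 : R := (cr12 u v)%:~R; pose n1 : R := - (cr02 u v)%:~R; pose n2 : R := (cr01 u v)%:~R.
pose N := n0 + n1 * xi + n2 * xi ^+ 3.
have hN n : (m <= n)%N -> `|(x n 0 c0)%:~R| * `|N| <= `|n1| + `|n2|.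
  move=> mn; have [a [b hab]] := span n mn.
  have n1' : (1 <= n)%N by apply: leq_trans mn.
  have hdet : det3 u v (x n) = 0.
    rewrite hab /det3 /cr01 /cr02 /cr12 !mxE.
    move: (u 0 c0) (u 0 c1) (u 0 c2) (v 0 c0) (v 0 c1) (v 0 c2) => *; ring.
  have := congr1 (intr : int -> R) hdet.
  rewrite /det3 !rmorphD rmorphN !rmorphM mulr0z /= -mulNr -/n0 -/n1 -/n2 => hd.
  have [d1 d2] := dist_coord xi (x n).
  have Ln : dist xi (x n) <= 1.
    by apply/ltW; apply: lt_trans (dist_lt_half hx n1') _; lra.
  rewrite -normrM.
  have -> : (x n 0 c0)%:~R * N = - (n1 * ((x n 0 c1)%:~R - (x n 0 c0)%:~R * xi)
     + n2 * ((x n 0 c2)%:~R - (x n 0 c0)%:~R * xi ^+ 3)).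
    by apply/eqP; rewrite -subr_eq0 -hd /N; apply/eqP; ring.
  rewrite normrN; apply: le_trans (ler_normD _ _) _; rewrite !normrM.
  by rewrite lerD // ler_piMr //; [exact: le_trans d1 _|exact: le_trans d2 _].
have N0 : N = 0.
  apply/eqP; rewrite -normr_eq0; apply: contraT => N0.
  have Np : 0 < `|N| by rewrite lt_def N0 normr_ge0.
  (* A bound for the norms of the x_n if N were non-zero. *)
  pose B := (kap - 1) * ((`|n1| + `|n2|) / `|N|) + 1.
  pose n := (m + Num.truncn B).+1.
  have mn : (m <= n)%N by rewrite /n ltnW // ltnS leq_addr.
  have n1' : (1 <= n)%N by [].
  have := ht_ge hx n1'; rewrite leNgt => /negP; case.
  apply: le_lt_trans (ht_le_coord0 xi (x n)) _.
  apply: le_lt_trans (_ : B < n%:R).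
    rewrite /B lerD //.
      rewrite ler_wpM2l //; first by have := cross_const_ge2 xi; lra.
      by rewrite ler_pdivlMr // hN.
    by apply/ltW; apply: lt_trans (dist_lt_half hx n1') _; lra.
  apply: lt_le_trans (Num.Theory.truncnS_gt _) _.
  by rewrite ler_nat /n ltnS leq_addl.
have := hxi (cr12 u v)%:~R (- cr02 u v)%:~R (cr01 u v)%:~R.
rewrite !ratr_int rmorphN -/n0 -/n1 -/n2 => /(_ N0)[].
move=> /eqP; rewrite intr_eq0 => /eqP h12.
move=> /eqP; rewrite intr_eq0 oppr_eq0 => /eqP h02.
move=> /eqP; rewrite intr_eq0 => /eqP h01.
exact: (@cross_neq0 m).
Qed.
End Heights.

(** * Non-vanishing of phi at minimal points *)

Section Phi.

(** The rational points of the cubic x0^2 x2 = x1^3 with x0 non-zero are the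
    multiples of the points (a^3, a^2 b, b^3). *)
Lemma cuspidal_factorization (x0 x1 x2 : int) : x0 != 0 ->
  x0 ^+ 2 * x2 = x1 ^+ 3 ->
  exists a b h : int, [/\ a != 0, h != 0, coprimez a b &
    [/\ x0 = a ^+ 3 * h, x1 = a ^+ 2 * b * h & x2 = b ^+ 3 * h]].
Proof.
move=> x00 hphi.
pose g := gcdz x0 x1.
have g0 : g != 0 by rewrite gcdz_eq0 negb_and x00.
have [a ha] := dvdzP (dvdz_gcdl x0 x1); have [b hb] := dvdzP (dvdz_gcdr x0 x1).
rewrite -/g in ha hb.
have a0 : a != 0 by apply: contraNneq x00 => a0; rewrite ha a0 mul0r.
have cop : coprimez a b.
  have : gcdz x0 x1 = gcdz a b * g.
    by rewrite {1}ha {1}hb -mulz_gcdl ?normr_ge0 // /g ger0_norm.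
  rewrite /coprimez -/g => /eqP; rewrite -{1}[g]mul1r (inj_eq (mulIf g0)) eq_sym //.
have h1 : a ^+ 2 * x2 = b ^+ 3 * g.
  apply: (mulIf (expf_neq0 2 g0)).
  by move: hphi; rewrite {1}ha hb => h; rewrite -[RHS]mulrA -exprS -exprMn -h; ring.
have [h hh] : exists h, g = h * a ^+ 2.
  apply/dvdzP; rewrite -(@Gauss_dvdzr _ (b ^+ 3)); first by apply/dvdzP; exists x2; rewrite -h1 mulrC.
  by rewrite coprimezXl // coprimezXr.
have h0 : h != 0 by apply: contraNneq g0 => h0; rewrite hh h0 mul0r.
exists a, b, h; split=> //; split.
- by rewrite {1}ha hh; ring.
- by rewrite hb hh; ring.
apply: (mulfI (expf_neq0 2 a0)); rewrite h1 hh; ring.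
Qed.

Variables (R : realType) (xi : R) (x : nat -> 'rV[int]_3).
Hypothesis hx : minimal_points xi x.
Notation X i := (ht R (x i)).
Notation L i := (dist xi (x i)).
Local Notation kap := (cross_const xi).

(** If phi(x) = 0, where x = h (a^3, a^2 b, b^3) and y is the preceding minimal
    point, then the first component of the cross product is a multiple of a^2 h,
    and, once it is 0, the second one is a multiple of a h.  Both divisors are
    at least |x_0|^{1/3}, while the cross product is smaller than that.  So it
    vanishes, which is absurd. *)
Lemma phi_neq0 i : (1 <= i)%N -> (kap * (X i.+1 * L i)) ^+ 3 * kap < X i.+1 ->
  phi (x i.+1 0) != 0.
Proof.
move=> i1 small; apply/negP => /eqP hphi.
have [c01 c02 c12] := cross_consecutive hx i1.
set H := kap * _ in small c01 c02 c12.
have k2 := cross_const_ge2 xi.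
have H0 : 0 <= H by apply: le_trans c01.
have x01 : (1 : R) <= `|(x i.+1 0 c0)%:~R| /\ H ^+ 3 < `|(x i.+1 0 c0)%:~R|.
  have hX := ht_le_coord0 xi (x i.+1).
  have hL := dist_lt_half hx (i := i.+1) isT.
  have X1 : 1 <= X i.+1 by apply: ht_ge1; exact: (min_neq0 hx).
  have x0 : x i.+1 0 c0 != 0.
    by apply/negP => /eqP h0; move: hX; rewrite h0 normr0 mulr0; lra.
  have x1 : (1 : R) <= `|(x i.+1 0 c0)%:~R|.
    by rewrite -intr_norm ler1z -gtz0_ge1 normr_gt0.
  split=> //; rewrite -(ltr_pM2r (_ : 0 < kap)); last lra.
  apply: lt_le_trans small _; apply: le_trans hX _; lra.
case: x01 => x01 Hx.
have x00 : x i.+1 0 c0 != 0.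
  by apply/negP => /eqP h0; move: x01; rewrite h0 normr0; lra.
have [a [b [h [a0 h0 cop [e0 e1 e2]]]]] := cuspidal_factorization x00 (subr0_eq hphi).
set y := x i in c01 c02 c12; set w := x i.+1 in c01 c02 c12 x01 Hx e0 e1 e2.
have a1 : (1 <= `|a|)%R by rewrite -gtz0_ge1 normr_gt0.
have h1 : (1 <= `|h|)%R by rewrite -gtz0_ge1 normr_gt0.
(* An integer multiple of p is too small to be non-zero. *)
have kill (p q : int) : `|(p * q)%:~R| <= H -> `|w 0 c0| <= `|p| ^+ 3 -> q = 0.
  move=> hpq hp; apply/eqP; apply: contraT => q0; exfalso.
  have : `|p|%:~R <= H :> R.
    apply: le_trans hpq; rewrite -intr_norm ler_int normrM ler_peMr //.
    by rewrite -gtz0_ge1 normr_gt0.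
  move=> /(lerXn2r 3); rewrite !nnegrE ler0z => /(_ isT H0).
  rewrite leNgt => /negP; apply; apply: lt_le_trans Hx _.
  by rewrite -rmorphXn -intr_norm ler_int.
have a2 : (1 <= `|a| ^+ 2)%R by rewrite exprn_ege1.
have a3 : (0 <= `|a| ^+ 3)%R by rewrite exprn_ge0.
have q01 : y 0 c0 * b - y 0 c1 * a = 0.
  apply: (kill (a ^+ 2 * h)); last first.
    rewrite e0 normrM normrX (normrM (a ^+ 2)) normrX exprMn -exprM.
    by apply: ler_pM; rewrite ?exprn_ge0 //; [rewrite ler_weXn2l|rewrite -{1}[`|h|]expr1 ler_weXn2l].
  rewrite (_ : _ * _ = cr01 y w) // /cr01 e0 e1; ring.
have [m hm] : exists m, y 0 c0 = m * a.
  apply/dvdzP; rewrite -(@Gauss_dvdzl _ _ b) //.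
  by apply/dvdzP; exists (y 0 c1); exact: (subr0_eq q01).
have hm1 : y 0 c1 = m * b.
  by apply: (mulIf a0); rewrite -(subr0_eq q01) hm; ring.
have q02 : m * b ^+ 3 - y 0 c2 * a ^+ 2 = 0.
  apply: (kill (a * h)); last first.
    rewrite e0 normrM normrX normrM exprMn.
    by apply: ler_pM; rewrite ?exprn_ge0 // -{1}[`|h|]expr1 ler_weXn2l.
  rewrite (_ : _ * _ = cr02 y w) // /cr02 e0 e2 hm; ring.
apply: (cross_neq0 hx i1); rewrite -/y -/w.
- have -> : cr01 y w = a ^+ 2 * h * (y 0 c0 * b - y 0 c1 * a).
    by rewrite /cr01 e0 e1; ring.
  by rewrite q01 mulr0.
- have -> : cr02 y w = a * h * (m * b ^+ 3 - y 0 c2 * a ^+ 2).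
    by rewrite /cr02 e0 e2 hm; ring.
  by rewrite q02 mulr0.
- have -> : cr12 y w = b * h * (m * b ^+ 3 - y 0 c2 * a ^+ 2).
    by rewrite /cr12 e1 e2 hm1; ring.
  by rewrite q02 mulr0.
Qed.
End Phi.

(** * Size of the covariants near the curve (1 : t : t^3) *)

Section FormBounds.
Variables (R : realType) (xi : R).
Implicit Types u v : 'I_3 -> R.

(** A common bound for 1, 3 |xi| and the norm of (b, a) |-> b - 3 xi^2 a. *)
Definition form_const : R := 1 + 3 * `|xi| + 3 * `|xi| ^+ 2.

Lemma form_const_ge1 : 1 <= form_const.
Proof. by rewrite /form_const -addrA lerDl addr_ge0 ?mulr_ge0 ?exprn_ge0. Qed.

Definition dev1 u := u c1 - u c0 * xi.
Definition dev2 u := u c2 - u c0 * xi ^+ 3.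
(** The differential of phi at (1, xi, xi^3) applied to the deviation of u; it
    carries the main terms of S, T and U. *)
Definition theta u := dev2 u - 3 * xi ^+ 2 * dev1 u.

Lemma phi_expand u : phi u =
  u c0 ^+ 2 * theta u - (3 * xi * u c0 * dev1 u ^+ 2 + dev1 u ^+ 3).
Proof. rewrite /phi /theta /dev1 /dev2; ring. Qed.

Definition remT u v := u c0 ^+ 2 * theta v
  - (6 * xi * u c0 * dev1 u * dev1 v + 3 * dev1 u ^+ 2 * dev1 v).

Lemma formT_expand u v : formT u v =
  2 * u c0 * v c0 * theta u + (remT u v - 3 * xi * v c0 * dev1 u ^+ 2).
Proof. rewrite /formT /Phi /remT /theta /dev1 /dev2; ring. Qed.

Definition remU u v := 2 * u c0 * v c0 * theta v
  - (3 * xi * u c0 * dev1 v ^+ 2 + 6 * xi * v c0 * dev1 u * dev1 v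
     + 3 * dev1 u * dev1 v ^+ 2).

Lemma formU_expand u v : Phi u v v = v c0 ^+ 2 * theta u + remU u v.
Proof. rewrite /Phi /remU /theta /dev1 /dev2; ring. Qed.

(** With S ~ x0^2 theta, T ~ 2 x0 y0 theta, U ~ y0^2 theta the leading terms of
    T^2 - 4SU cancel, and so do the terms in 3 xi x0 y0^2 theta dev1^2 coming
    from the corrections to T and S. *)
Lemma formF_expand u v : formF u v =
  4 * u c0 * v c0 * theta u * remT u v
  + (remT u v - 3 * xi * v c0 * dev1 u ^+ 2) ^+ 2
  - 4 * u c0 ^+ 2 * theta u * remU u v
  + 4 * v c0 ^+ 2 * theta u * dev1 u ^+ 3
  + 4 * (3 * xi * u c0 * dev1 u ^+ 2 + dev1 u ^+ 3) * remU u v.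
Proof. rewrite /formF phi_expand formT_expand formU_expand; ring. Qed.

Variables (u v : 'I_3 -> R) (P Q l l' : R).
Hypotheses (hu0 : `|u c0| <= P) (hv0 : `|v c0| <= Q).
Hypotheses (hu1 : `|dev1 u| <= l) (hu2 : `|dev2 u| <= l).
Hypotheses (hv1 : `|dev1 v| <= l') (hv2 : `|dev2 v| <= l').
Hypotheses (hll : l' <= l) (hl : l <= 1) (hP : 1 <= P) (hPQ : P <= Q).
Local Notation k := form_const.

Lemma theta_bound w m : `|dev1 w| <= m -> `|dev2 w| <= m -> `|theta w| <= k * m.
Proof.
move=> h1 h2; have m0 : 0 <= m by apply: le_trans h1.
have h3 : `|3 * xi ^+ 2| <= 3 * `|xi| ^+ 2 by rewrite normrM normr_nat normrX.
apply: le_trans (norm_sub_le h2 (norm_mul_le h3 h1)) _.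
have : 0 <= `|xi| * m by rewrite mulr_ge0.
rewrite /form_const; lra.
Qed.

Lemma norm_3xi_le : `|3 * xi| <= k.
Proof.
rewrite normrM normr_nat /form_const; have : 0 <= `|xi| ^+ 2 by rewrite exprn_ge0.
lra.
Qed.

Let l0 : 0 <= l. Proof. by apply: le_trans hu1. Qed.
Let l'0 : 0 <= l'. Proof. by apply: le_trans hv1. Qed.
Let P0 : 0 <= P. Proof. exact: le_trans ler01 hP. Qed.
Let Q0 : 0 <= Q. Proof. exact: le_trans P0 hPQ. Qed.
Let lP : l <= P. Proof. exact: le_trans hl hP. Qed.
Let l'1 : l' <= 1. Proof. exact: le_trans hll hl. Qed.
Let l'Q : l' <= Q. Proof. exact: le_trans hll (le_trans lP hPQ). Qed.
Let k0 : 0 <= k. Proof. exact: le_trans ler01 form_const_ge1. Qed.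

Lemma norm_exp_le (a A : R) n : `|a| <= A -> `|a ^+ n| <= A ^+ n.
Proof. by move=> h; rewrite normrX lerXn2r ?nnegrE // (le_trans _ h). Qed.

Lemma norm_nat_mul (n : nat) (a A : R) : `|a| <= A -> `|n%:R * a| <= n%:R * A.
Proof. by move=> h; rewrite normrM normr_nat ler_wpM2l. Qed.

Lemma remS_bound w X m : `|w c0| <= X -> `|dev1 w| <= m -> 1 <= X -> m <= 1 ->
  `|3 * xi * w c0 * dev1 w ^+ 2 + dev1 w ^+ 3| <= 2 * k * (X * m ^+ 2).
Proof.
move=> h0 h1 X1 m1; have m0 : 0 <= m by apply: le_trans h1.
apply: le_trans (norm_add_le (norm_mul_le (norm_mul_le norm_3xi_le h0)
  (norm_exp_le 2 h1)) (norm_exp_le 3 h1)) _.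
have : m ^+ 3 <= k * (X * m ^+ 2).
  rewrite exprS [leRHS]mulrA; apply: ler_wpM2r; first by rewrite exprn_ge0.
  by apply: le_trans m1 _; rewrite -[leLHS]mulr1 ler_pM // form_const_ge1.
lra.
Qed.

Lemma phi_bound w X m : `|w c0| <= X -> `|dev1 w| <= m -> `|dev2 w| <= m ->
  1 <= X -> m <= 1 -> `|phi w| <= 3 * k * (X ^+ 2 * m).
Proof.
move=> h0 h1 h2 X1 m1; have m0 : 0 <= m by apply: le_trans h1.
rewrite phi_expand; apply: le_trans (norm_sub_le (norm_mul_le (norm_exp_le 2 h0)
  (theta_bound h1 h2)) (remS_bound h0 h1 X1 m1)) _.
have : 2 * k * (X * m ^+ 2) <= 2 * k * (X ^+ 2 * m).
  rewrite ler_wpM2l ?mulr_ge0 // !expr2 -mulrA ler_wpM2l //; first lra.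
  by rewrite ler_wpM2r //; lra.
lra.
Qed.

Lemma remT_bound : `|remT u v| <= 6 * k * (P ^+ 2 * l').
Proof.
have h1 := norm_mul_le (norm_exp_le 2 hu0) (theta_bound hv1 hv2).
have h2 := norm_mul_le (norm_mul_le (norm_mul_le norm_3xi_le hu0) hu1) hv1.
have h3 := norm_mul_le (norm_exp_le 2 hu1) hv1.
have e2 : `|6 * xi * u c0 * dev1 u * dev1 v| <= 2 * (k * P * l * l').
  by rewrite (_ : _ * dev1 v = 2 * (3 * xi * u c0 * dev1 u * dev1 v)); [exact: norm_nat_mul|ring].
have e3 : `|3 * dev1 u ^+ 2 * dev1 v| <= 3 * (l ^+ 2 * l').
  by rewrite -mulrA; exact: norm_nat_mul.
apply: le_trans (norm_sub_le h1 (norm_add_le e2 e3)) _.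
have i2 : k * P * l * l' <= k * (P ^+ 2 * l').
  by rewrite expr2 -!mulrA ler_wpM2l // ler_wpM2l // ler_wpM2r.
have i3 : l ^+ 2 * l' <= k * (P ^+ 2 * l').
  rewrite mulrA ler_wpM2r // -[leLHS]mul1r ler_pM ?exprn_ge0 ?form_const_ge1 //.
  by rewrite lerXn2r ?nnegrE.
lra.
Qed.

Lemma remT_shifted_bound : `|remT u v - 3 * xi * v c0 * dev1 u ^+ 2|
  <= 6 * k * (P ^+ 2 * l') + k * (Q * l ^+ 2).
Proof.
apply: le_trans (norm_sub_le remT_bound (norm_mul_le (norm_mul_le norm_3xi_le hv0)
  (norm_exp_le 2 hu1))) _.
by rewrite (mulrA k Q).
Qed.

Lemma remU_bound : `|remU u v| <= 8 * k * (P * Q * l').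
Proof.
have h1 := norm_mul_le (norm_mul_le hu0 hv0) (theta_bound hv1 hv2).
have h2 := norm_mul_le (norm_mul_le norm_3xi_le hu0) (norm_exp_le 2 hv1).
have h3 := norm_mul_le (norm_mul_le (norm_mul_le norm_3xi_le hv0) hu1) hv1.
have h4 := norm_mul_le hu1 (norm_exp_le 2 hv1).
have e1 : `|2 * u c0 * v c0 * theta v| <= 2 * (P * Q * (k * l')).
  by rewrite -2!mulrA; rewrite -(mulrA (u c0)) in h1; exact: norm_nat_mul.
have e3 : `|6 * xi * v c0 * dev1 u * dev1 v| <= 2 * (k * Q * l * l').
  by rewrite (_ : _ * dev1 v = 2 * (3 * xi * v c0 * dev1 u * dev1 v)); [exact: norm_nat_mul|ring].
have e4 : `|3 * dev1 u * dev1 v ^+ 2| <= 3 * (l * l' ^+ 2).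
  by rewrite -mulrA; exact: norm_nat_mul.
apply: le_trans (norm_sub_le e1 (norm_add_le (norm_add_le h2 e3) e4)) _.
have k1 := form_const_ge1.
have i2 : k * P * l' ^+ 2 <= k * (P * Q * l').
  by rewrite expr2 -!mulrA ler_wpM2l // ler_wpM2l // ler_wpM2r.
have i3 : k * Q * l * l' <= k * (P * Q * l').
  by rewrite -!mulrA ler_wpM2l // [leRHS]mulrCA ler_wpM2l // ler_wpM2r.
have i4 : l * l' ^+ 2 <= k * (P * Q * l').
  rewrite expr2 -[leLHS]mul1r ler_pM ?mulr_ge0 // mulrA ler_wpM2r //.
  by rewrite ler_pM.
lra.
Qed.

Lemma formT_bound : `|formT u v| <= 9 * k * (P * Q * l).
Proof.
have h1 := norm_mul_le (norm_mul_le hu0 hv0) (theta_bound hu1 hu2).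
have e1 : `|2 * u c0 * v c0 * theta u| <= 2 * (P * Q * (k * l)).
  by rewrite -2!mulrA; rewrite -(mulrA (u c0)) in h1; exact: norm_nat_mul.
rewrite formT_expand; apply: le_trans (norm_add_le e1 remT_shifted_bound) _.
have i1 : P ^+ 2 * l' <= P * Q * l.
  by rewrite expr2; apply: ler_pM; rewrite ?mulr_ge0 // ler_wpM2l.
have i2 : Q * l ^+ 2 <= P * Q * l.
  by rewrite expr2 mulrA ler_wpM2r // mulrC ler_wpM2r.
have := ler_wpM2l k0 i1; have := ler_wpM2l k0 i2; lra.
Qed.

Lemma formF_bound :
  `|formF u v| <= 196 * k ^+ 2 * (P ^+ 3 * Q * l * l' + Q ^+ 2 * l ^+ 4).
Proof.
have ht := theta_bound hu1 hu2.
have rU := remU_bound; have rT := remT_bound; have rT' := remT_shifted_bound.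
have rS := remS_bound hu0 hu1 hP hl.
have k1 := form_const_ge1.
set E1 := P ^+ 3 * Q * l * l'; set E2 := Q ^+ 2 * l ^+ 4.
have kk : 0 <= k ^+ 2 by rewrite exprn_ge0.
have E10 : 0 <= E1 by rewrite /E1 !mulr_ge0 // exprn_ge0.
have E20 : 0 <= E2 by rewrite /E2 !mulr_ge0 // exprn_ge0.
have t1 : `|4 * u c0 * v c0 * theta u * remT u v| <= 24 * k ^+ 2 * E1.
  have -> : 4 * u c0 * v c0 * theta u * remT u v
    = 4%:R * (u c0 * v c0 * theta u * remT u v) by ring.
  apply: le_trans (norm_nat_mul 4 (norm_mul_le (norm_mul_le (norm_mul_le hu0 hv0) ht) rT)) _.
  by rewrite le_eqVlt; apply/orP; left; apply/eqP; rewrite /E1; ring.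
have t2 : `|(remT u v - 3 * xi * v c0 * dev1 u ^+ 2) ^+ 2| <= 72 * k ^+ 2 * (E1 + E2).
  apply: le_trans (norm_exp_le 2 rT') _.
  apply: le_trans (_ : 2 * ((6 * k * (P ^+ 2 * l')) ^+ 2 + (k * (Q * l ^+ 2)) ^+ 2) <= _).
    rewrite -subr_ge0; set A := 6 * k * _; set B := k * (Q * _).
    have -> : 2 * (A ^+ 2 + B ^+ 2) - (A + B) ^+ 2 = (A - B) ^+ 2 by ring.
    exact: sqr_ge0.
  have i : (P ^+ 2 * l') ^+ 2 <= E1.
    have -> : (P ^+ 2 * l') ^+ 2 = P ^+ 3 * (P * (l' * l')) by ring.
    have -> : E1 = P ^+ 3 * (Q * (l * l')) by rewrite /E1; ring.
    rewrite ler_wpM2l ?exprn_ge0 //.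
    by apply: ler_pM; rewrite ?mulr_ge0 // ler_wpM2r.
  have := ler_wpM2l kk i.
  have -> : k ^+ 2 * (P ^+ 2 * l') ^+ 2 = (k * (P ^+ 2 * l')) ^+ 2 by ring.
  have : 0 <= k ^+ 2 * E2 by rewrite mulr_ge0.
  have -> : (6 * k * (P ^+ 2 * l')) ^+ 2 = 36 * (k * (P ^+ 2 * l')) ^+ 2 by ring.
  have -> : (k * (Q * l ^+ 2)) ^+ 2 = k ^+ 2 * E2 by rewrite /E2; ring.
  lra.
have t3 : `|4 * u c0 ^+ 2 * theta u * remU u v| <= 32 * k ^+ 2 * E1.
  have -> : 4 * u c0 ^+ 2 * theta u * remU u v
    = 4%:R * (u c0 ^+ 2 * theta u * remU u v) by ring.
  apply: le_trans (norm_nat_mul 4 (norm_mul_le (norm_mul_le (norm_exp_le 2 hu0) ht) rU)) _.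
  by rewrite le_eqVlt; apply/orP; left; apply/eqP; rewrite /E1; ring.
have t4 : `|4 * v c0 ^+ 2 * theta u * dev1 u ^+ 3| <= 4 * k ^+ 2 * E2.
  have -> : 4 * v c0 ^+ 2 * theta u * dev1 u ^+ 3
    = 4%:R * (v c0 ^+ 2 * theta u * dev1 u ^+ 3) by ring.
  apply: le_trans (norm_nat_mul 4 (norm_mul_le (norm_mul_le (norm_exp_le 2 hv0) ht) (norm_exp_le 3 hu1))) _.
  have -> : 4 * (Q ^+ 2 * (k * l) * l ^+ 3) = 4 * k * E2 by rewrite /E2; ring.
  by apply: ler_wpM2r => //; rewrite expr2 mulrA ler_peMr // mulr_ge0.
have t5 : `|4 * (3 * xi * u c0 * dev1 u ^+ 2 + dev1 u ^+ 3) * remU u v| <= 64 * k ^+ 2 * E1.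
  rewrite -mulrA.
  apply: le_trans (norm_nat_mul 4 (norm_mul_le rS rU)) _.
  have -> : 4%:R * (2 * k * (P * l ^+ 2) * (8 * k * (P * Q * l')))
     = 64 * k ^+ 2 * (P ^+ 2 * Q * l * l' * l) by ring.
  rewrite ler_wpM2l ?mulr_ge0 //.
  have -> : E1 = P ^+ 2 * Q * l * l' * P by rewrite /E1; ring.
  by rewrite ler_wpM2l // !mulr_ge0 // exprn_ge0.
rewrite formF_expand.
apply: le_trans (norm_add_le (norm_add_le (norm_sub_le (norm_add_le t1 t2) t3) t4) t5) _.
have := mulr_ge0 kk E10; have := mulr_ge0 kk E20; lra.
Qed.

Lemma formW_bound : `|formW u v| <= 27 * k ^+ 3 * (P ^+ 4 * l ^+ 2 * (Q ^+ 2 * l')).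
Proof.
have Q1 : 1 <= Q by exact: le_trans hP hPQ.
have hU := phi_bound hu0 hu1 hu2 hP hl; have hV := phi_bound hv0 hv1 hv2 Q1 l'1.
apply: le_trans (norm_mul_le (norm_exp_le 2 hU) hV) _.
by rewrite le_eqVlt; apply/orP; left; apply/eqP; ring.
Qed.
End FormBounds.

(** * Logarithmic estimates along the minimal points *)

Section Logs.
Variables (R : realType) (xi : R) (x : nat -> 'rV[int]_3).
Hypothesis hx : minimal_points xi x.
Notation X i := (ht R (x i)).
Notation L i := (dist xi (x i)).
Notation A i := (ln (ht R (x i))).
Notation D i := (ln (dist xi (x i))).
Local Notation kap := (cross_const xi).
Local Notation k := (form_const xi).

Lemma minimal_ht_ge1 i : (1 <= i)%N -> 1 <= X i.
Proof. by move=> i1; apply/ht_ge1/(min_neq0 hx). Qed.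

Lemma expR_ht i : (1 <= i)%N -> expR (A i) = X i.
Proof. by move=> /minimal_ht_ge1 h; rewrite lnK // posrE; apply: lt_le_trans h. Qed.

Lemma expR_dist i : (1 <= i)%N -> expR (D i) = L i.
Proof. by move=> /(dist_gt0 hx) h; rewrite lnK // posrE. Qed.

Lemma lnht_ge0 i : (1 <= i)%N -> 0 <= A i.
Proof. by move=> /minimal_ht_ge1; exact: ln_ge0. Qed.

Lemma lnht_le i j : (1 <= i <= j)%N -> A i <= A j.
Proof.
move=> /andP[i1 ij]; rewrite -ler_expR !expR_ht //; last exact: leq_trans ij.
by apply: (ht_le hx); rewrite i1.
Qed.

Lemma lnht_unbounded (B : R) : exists n : nat, forall i, (n <= i)%N ->
  (2 <= i)%N /\ B <= A i.
Proof.
exists (maxn 2 (Num.truncn (expR B)).+1) => i; rewrite geq_max => /andP[i2 hi].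
have i1 : (1 <= i)%N by apply: leq_trans i2.
split=> //; rewrite -ler_expR expR_ht //.
apply: le_trans (ht_ge hx i1); apply: ltW.
by apply: lt_le_trans (Num.Theory.truncnS_gt _) _; rewrite ler_nat.
Qed.

(** Apply the hypothesis just below X_{i+1}, here at X_{i+1} / 2: a point of
    smaller norm than x_{i+1} is no closer than x_i. *)
Lemma dist_log_bound (lambda c l : R) : 0 < c -> 0 < lambda -> l <= lambda ->
  (exists X0 : R, forall Y : R, X0 <= Y ->
     exists y : 'rV[int]_3,
       [/\ y != 0, supnorm (toR R y) <= Y
         & Ldist xi (toR R y) <= c * Y `^ (- lambda)]) ->
  exists K n : nat, forall i, (n <= i)%N -> D i <= K%:R - l * A i.+1.
Proof.
move=> c0 la0 lla [X0 hX0].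
pose K0 := ln c + lambda * ln 2.
have [n hn] := lnht_unbounded (ln (2 * Num.max X0 1)).
exists (Num.truncn K0).+1, n => i ni.
have [i2 _] := hn i ni; have i1 : (1 <= i)%N by apply: leq_trans i2.
have [_ hA] := hn i.+1 (leqW ni).
have Xp : 0 < X i.+1 by apply: lt_le_trans (minimal_ht_ge1 (i := i.+1) isT).
have hX : X0 <= X i.+1 / 2.
  rewrite ler_pdivlMr // mulrC.
  apply: le_trans (_ : 2 * Num.max X0 1 <= _); first by rewrite ler_wpM2l // le_max lexx.
  by rewrite -ler_ln ?posrE // mulr_gt0 // lt_max ltr01 orbT.
have [y [y0 hy1 hy2]] := hX0 _ hX.
have hL : L i <= c * (X i.+1 / 2) `^ (- lambda).
  apply: le_trans hy2; rewrite leNgt; apply/negP => hlt.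
  have := minimal_ht_lower hx i1 y0 hlt; rewrite leNgt => /negP; apply.
  apply: le_lt_trans hy1 _; rewrite ltr_pdivrMr //; move: Xp; clear -hx; lra.
have X2 : 0 < X i.+1 / 2 by rewrite divr_gt0.
have hD : D i <= K0 - lambda * A i.+1.
  apply: le_trans (_ : ln (c * (X i.+1 / 2) `^ (- lambda)) <= _).
    by rewrite ler_ln ?posrE ?mulr_gt0 ?powR_gt0 //; exact: (dist_gt0 hx).
  rewrite lnM ?posrE ?powR_gt0 // ln_powR ln_div ?posrE // /K0; lra.
apply: le_trans hD _; apply: lerB; first by apply/ltW/Num.Theory.truncnS_gt.
by rewrite ler_wpM2r // lnht_ge0.
Qed.

Variables (l1 l2 : R) (K n1 : nat).
Hypotheses (h12 : l1 < l2) (hl1 : 7 / 10 <= l1) (hl2 : l2 <= 71 / 100).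
Hypothesis hD : forall i, (n1 <= i)%N -> D i <= K%:R - l2 * A i.+1.

(** 1 <= |phi(x_i)| << X_i^2 L_i.  The condition of [phi_neq0] is met because
    3 (1 - l2) < 1. *)
Lemma phi_growth : exists n, forall i, (n <= i)%N -> l1 * A i.+1 <= 2 * A i.
Proof.
pose B0 := 10 * (4 * ln kap + 3 * K%:R) + 1.
pose B1 := (ln (3 * k) + K%:R) / (l2 - l1).
have [na hna] := lnht_unbounded B0; have [nb hnb] := lnht_unbounded B1.
exists (maxn (maxn na nb) n1).+1 => -[//|i]; rewrite ltnS !geq_max => /andP[/andP[ia ib] i1].
have [i2 _] := hna i ia; have ii : (1 <= i)%N by apply: leq_trans i2.
have [_ hc0] := hna i.+1 (leqW ia).
have [_ hc1] := hnb i.+2 (leqW (leqW ib)).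
have kap0 : 0 < kap by have := cross_const_ge2 xi; lra.
have k0 : 0 < 3 * k by have := form_const_ge1 xi; lra.
have small : (kap * (X i.+1 * L i)) ^+ 3 * kap < X i.+1.
  have -> : kap = expR (ln kap) by rewrite lnK.
  rewrite -(expR_ht (i := i.+1)) // -expR_dist // -!expRD -expRM_natl -expRD ltr_expR.
  have := hD i1; have hA0 := lnht_ge0 (i := i.+1) isT.
  have : 7 / 10 * A i.+1 <= l2 * A i.+1.
    by rewrite ler_wpM2r //; apply: le_trans hl1 (ltW h12).
  move: hc0; rewrite /B0; clear -hx h12 hl1 hl2 hD; lra.
have y0 := phi_neq0 hx ii small.
have hphi : 1 <= `|phi (real_pt R (x i.+1))|.
  have -> : phi (real_pt R (x i.+1)) = (phi (x i.+1 0))%:~R.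
    by rewrite (rmorph_phi intr).
  by rewrite -intr_norm ler1z -gtz0_ge1 normr_gt0.
have [hy0 _ _] := ht_coord R (x i.+1); have [d1 d2] := dist_coord xi (x i.+1).
have X1 := minimal_ht_ge1 (i := i.+1) isT.
have L1 : L i.+1 <= 1.
  by apply/ltW; apply: lt_trans (dist_lt_half hx (i := i.+1) isT) _; lra.
have hb := phi_bound (w := real_pt R (x i.+1)) hy0 d1 d2 X1 L1.
have hlog : 0 <= ln (3 * k) + (2 * A i.+1 + D i.+1).
  rewrite -ler_expR expR0 !expRD expRM_natl lnK // expR_ht // expR_dist //.
  exact: le_trans hphi hb.
have := hD (leqW i1).
have : ln (3 * k) + K%:R <= (l2 - l1) * A i.+2.
  by move: hc1; rewrite /B1 ler_pdivrMr ?subr_gt0 // [leRHS]mulrC.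
lra.
Qed.

(** The constant in [height_inequality] is absorbed by the term in e. *)
Lemma heights_growth (e : R) : 0 < e -> exists n, forall i j, (n <= i)%N ->
  consecutive (indexI R x) i j ->
  A j <= (1 - l2) * (A i.+1 + A j.+1) + e * A i.+1.
Proof.
move=> e0; pose B0 := (ln (2 * kap ^+ 2) + 2 * K%:R) / e.
have [na hna] := lnht_unbounded B0.
exists (maxn na n1) => i j; rewrite geq_max => /andP[ia i1] hij.
have [ii ij _ _] := consecutive_span hx hij.
have jj : (1 <= j)%N by apply: leq_trans ij.
have hh := height_inequality hx hij.
have kap0 : 0 < 2 * kap ^+ 2.
  by rewrite mulr_gt0 // exprn_gt0 //; have := cross_const_ge2 xi; lra.
have hlog : A j <= ln (2 * kap ^+ 2) + (A i.+1 + D i) + (A j.+1 + D j).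
  rewrite -ler_expR !expRD !expR_ht // !expR_dist //.
  by rewrite lnK.
have := hD i1; have := hD (leq_trans i1 (ltnW ij)).
have [_ hc] := hna i.+1 (leqW ia).
have : ln (2 * kap ^+ 2) + 2 * K%:R <= e * A i.+1.
  by move: hc; rewrite /B0 ler_pdivrMr // [leRHS]mulrC.
move: hlog; clear -hx h12 hl1 hl2 hD; lra.
Qed.

Lemma log_bounds_eventually (M : R) : exists n, forall i j, (n <= i)%N ->
  consecutive (indexI R x) i j ->
  log_bounds l1 M (x i) (x j) (A i) (A i.+1) (A j) (A j.+1).
Proof.
pose cT := ln (9 * k); pose cF := ln (392 * k ^+ 2); pose cW := ln (27 * k ^+ 3).
pose B0 := (`|cT| + `|cF| + `|cW| + `|M| + 4 * K%:R) / (l2 - l1).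
have [na hna] := lnht_unbounded B0.
exists (maxn na n1) => i j; rewrite geq_max => /andP[ia i1] hij.
have [ii ij _ _] := consecutive_span hx hij.
have jj : (1 <= j)%N by apply: leq_trans ij.
have k1 := form_const_ge1 xi.
have k0 : 0 < k by apply: lt_le_trans k1.
have [hu0 _ _] := ht_coord R (x i); have [hu1 hu2] := dist_coord xi (x i).
have [hv0 _ _] := ht_coord R (x j); have [hv1 hv2] := dist_coord xi (x j).
have hll : L j <= L i by apply: (dist_le hx); rewrite ii ltnW.
have hl : L i <= 1.
  by apply/ltW; apply: lt_trans (dist_lt_half hx ii) _; lra.
have hP := minimal_ht_ge1 ii.
have hPQ : X i <= X j by apply: (ht_le hx); rewrite ii ltnW.
have bT := formT_bound (u := real_pt R (x i)) (v := real_pt R (x j))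
  hu0 hv0 hu1 hu2 hv1 hv2 hll hl hP hPQ.
have bF := formF_bound (u := real_pt R (x i)) (v := real_pt R (x j))
  hu0 hv0 hu1 hu2 hv1 hv2 hll hl hP hPQ.
have bW := formW_bound (u := real_pt R (x i)) (v := real_pt R (x j))
  hu0 hv0 hu1 hu2 hv1 hv2 hll hl hP hPQ.
have d1 := hD i1; have d2 := hD (leq_trans i1 (ltnW ij)).
have [_ hc] := hna i.+1 (leqW ia).
have slack : `|cT| + `|cF| + `|cW| + `|M| + 4 * K%:R <= (l2 - l1) * A i.+1.
  by move: hc; rewrite /B0 ler_pdivrMr ?subr_gt0 // [leRHS]mulrC.
have sl2 : 0 <= (l2 - l1) * A j.+1.
  by rewrite mulr_ge0 ?subr_ge0 ?(ltW h12) // lnht_ge0.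
have K0 : 0 <= K%:R :> R by rewrite ler0n.
have nT := ler_norm cT; have nF := ler_norm cF; have nW := ler_norm cW.
have nM := ler_norm M; have pT := normr_ge0 cT; have pF := normr_ge0 cF.
have pW := normr_ge0 cW; have pM := normr_ge0 M.
rewrite -(expR_ht ii) -(expR_ht jj) -(expR_dist ii) in bT bF bW.
rewrite -(expR_dist jj) in bF bW.
split.
- apply: le_trans bT _.
  have -> : 9 * k = expR cT by rewrite /cT lnK // posrE mulr_gt0.
  rewrite -!expRD ler_expR; move: slack d1 nT nM pF pW K0; clear -hx h12 hl1 hl2 hD; lra.
- apply: le_trans bF _.
  set m := Num.max _ _.
  have hm1 : 3 * A i + A j - l1 * A i.+1 - l1 * A j.+1 <= m by rewrite /m le_max lexx.
  have hm2 : 2 * A j - 4 * l1 * A i.+1 <= m by rewrite /m le_max lexx orbT.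
  have e1 : expR (A i) ^+ 3 * expR (A j) * expR (D i) * expR (D j) <= expR (m - M - cF).
    rewrite -expRM_natl -!expRD ler_expR.
    move: slack sl2 d1 d2 nF nM pT pW K0 hm1; clear -hx h12 hl1 hl2 hD; lra.
  have e2 : expR (A j) ^+ 2 * expR (D i) ^+ 4 <= expR (m - M - cF).
    rewrite -!expRM_natl -!expRD ler_expR.
    move: slack d1 nF nM pT pF pW pM K0 hm2; clear -hx h12 hl1 hl2 hD; lra.
  have kk : 0 < 392 * k ^+ 2 by rewrite mulr_gt0 // exprn_gt0.
  have -> : expR (m - M) = 392 * k ^+ 2 * expR (m - M - cF).
    by rewrite (expRB (m - M)) /cF lnK ?posrE // mulrCA mulfV ?mulr1 // gt_eqF.
  have -> : 392 * k ^+ 2 * expR (m - M - cF) = 196 * k ^+ 2 * (expR (m - M - cF) + expR (m - M - cF)).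
    by ring.
  by rewrite ler_wpM2l ?lerD // mulr_ge0 // exprn_ge0 // ltW.
- apply: le_trans bW _.
  have -> : 27 * k ^+ 3 = expR cW by rewrite /cW lnK // posrE mulr_gt0 // exprn_gt0.
  rewrite -!expRM_natl -!expRD ler_expR.
  move: slack sl2 d1 d2 nW nM pF pT pW pM K0; clear -hx h12 hl1 hl2 hD; lra.
Qed.
End Logs.

(** * Selection of good pairs and conclusion *)

Lemma consecutive_enumeration (I : nat -> Prop) :
  (forall m, exists2 i, (m <= i)%N & I i) ->
  exists e : nat -> nat, (forall n, (n <= e n)%N) /\
    forall n, consecutive I (e n) (e n.+1).
Proof.
move=> unb.
have next i : exists j, I i -> consecutive I i j.
  pose Q j := (i < j)%N && boolp.asbool (I j).
  have exQ : exists j, Q j.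
    by have [j ij Ij] := unb i.+1; exists j; rewrite /Q ij; apply/boolp.asboolP.
  case: (ex_minnP exQ) => j /andP[ij /boolp.asboolP Ij] jmin.
  exists j => Ii; split=> // m Im; apply/negP => /andP[im mj].
  by have := jmin m; rewrite /Q im /= leqNgt mj => /(_ (introT (boolp.asboolP _) Im)).
have [f hf] := boolp.choice next.
have [i0 _ hi0] := unb 0%N.
have he n : I (iter n f i0) by elim: n => //= n IH; case: (hf _ IH).
exists (fun n => iter n f i0); split=> [n|n]; last exact: hf (he n).
elim: n => // n IH; apply: leq_ltn_trans IH _.
by case: (hf _ (he n)).
Qed.

(** A bounded sequence cannot drop by more than e at every step. *)
Lemma almost_nondecreasing (R : archiRealFieldType) (u : nat -> R) (e : R) :
  0 < e -> (forall n, 0 <= u n <= 1) ->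
  forall N, exists2 n, (N <= n)%N & u n <= u n.+1 + e.
Proof.
move=> e0 hu N; apply: boolp.contrapT => hno.
have step n : (N <= n)%N -> u n.+1 <= u n - e.
  move=> Nn; rewrite leNgt; apply/negP => h; apply: hno; exists n => //.
  by rewrite -lerBlDr ltW.
have desc m : u (N + m)%N <= u N - m%:R * e.
  elim: m => [|m IH]; first by rewrite addn0 mul0r subr0.
  rewrite addnS -natr1 mulrDl mul1r opprD addrA.
  by apply: le_trans (step _ (leq_addr _ _)) _; rewrite lerD2r.
have := desc (Num.truncn (1 / e)).+1; apply/negP; rewrite -ltNge.
have : 1 < (Num.truncn (1 / e)).+1%:R * e.
  by rewrite -ltr_pdivrMr // Num.Theory.truncnS_gt.
have /andP[_] := hu N.
have /andP[+ _] := hu (N + (Num.truncn (1 / e)).+1)%N.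
move: (u N) (u _) (_ * e) => a b c'; clear; lra.
Qed.

Lemma finite_pairs_bounded (S : set (nat * nat)) : finite_set S ->
  exists m, forall p, S p -> (p.1 < m)%N.
Proof.
case/finite_seqP => s ->; exists (\sum_(p <- s) p.1).+1 => p /= ps.
by rewrite ltnS (big_rem p ps) /= leq_addr.
Qed.

(** The previous index h of I enters only through the last field of [growth]: a
    nearly non-decreasing ratio u bounds X_{h+1} by X_i^{u + eps}. *)
Lemma frequent_vanishing (PE : poly_family) (R : realType) (xi : R)
    (x : nat -> 'rV[int]_3) (l1 l2 : R) (K n1 : nat) :
  is_choice_of_P PE -> lin_indep_Q_1_xi_xi3 xi -> minimal_points xi x ->
  l1 < l2 -> 7 / 10 <= l1 -> l2 <= 71 / 100 ->
  0 < 11 * l1 ^+ 2 - 2 * l1 - 4 ->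
  (forall i, (n1 <= i)%N ->
     ln (dist xi (x i)) <= K%:R - l2 * ln (ht R (x i.+1))) ->
  exists2 d : nat, (0 < d)%N & forall N, exists i j,
    [/\ (N <= i)%N, consecutive (indexI R x) i j &
      exists E : {set 'I_d.+1 * 'I_d.+1},
        [/\ E != finset.set0, E \subset Tset d
          & eval_int (PE d E) (x i) (x j) = 0]].
Proof.
move=> hPE hxi hx h12 hl1 hl2 he hD.
pose A i := ln (ht R (x i)).
have hl : 7 / 10 <= l1 <= 71 / 100 by rewrite hl1 /=; apply/ltW/(lt_le_trans h12).
have [d [M [d0 hpair]]] := pair_forces_vanishing hPE hl he.
exists d => // N.
have [e [en he2]] := consecutive_enumeration (indexI_unbounded hx hxi).
pose eps := (l2 - l1) / 2.
have eps0 : 0 < eps by rewrite divr_gt0 // subr_gt0.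
have [na hna] := lnht_unbounded hx 1.
have [nb hnb] := phi_growth hx h12 hl1 hD.
have [nc hnc] := heights_growth hx hD eps0.
have [nd hnd] := log_bounds_eventually hx h12 hD M.
pose u n := A (e n).+1 / A (e n.+1).
pose n0 := (N + na + nb + nc + nd)%N.
have A1 i : (na <= i)%N -> 1 <= A i by move=> /hna[].
have i2 i : (na <= i)%N -> (1 <= i)%N by move=> /hna[/ltnW].
have ge m : (n0 <= m)%N -> [/\ (N <= m)%N, (na <= m)%N, (nb <= m)%N, (nc <= m)%N & (nd <= m)%N].
  by rewrite /n0 => hm; split; apply: leq_trans hm; clear; lia.
have hu n : 0 <= u (n0 + n)%N <= 1.
  have [_ hn _ _ _] := ge _ (leq_trans (leq_addr n n0) (en _)).
  have [_ _ lt_e _] := he2 (n0 + n)%N.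
  have a1 := A1 _ (leq_trans hn (ltnW lt_e)); have a2 := A1 _ (leqW hn).
  rewrite /u divr_ge0 ?(le_trans ler01) //= ler_pdivrMr ?(lt_le_trans ltr01) // mul1r.
  by apply: (lnht_le hx); rewrite lt_e.
have [n _ hun] := almost_nondecreasing eps0 hu 0%N.
set h := e (n0 + n)%N; set i := e (n0 + n).+1; set j := e (n0 + n).+2.
have hhi : consecutive (indexI R x) h i := he2 _.
have hij : consecutive (indexI R x) i j := he2 _.
have hh : (n0 <= h)%N by apply: leq_trans (en _); rewrite leq_addr.
have [_ _ lhi _] := hhi; have [_ _ lij _] := hij.
have ii : (n0 <= i)%N by apply: leq_trans (ltnW lhi).
have jj : (n0 <= j)%N by apply: leq_trans (ltnW lij).
have [iN ina inb inc ind] := ge _ ii; have [_ jna jnb jnc jnd] := ge _ jj.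
have [_ hna' _ hnc' _] := ge _ hh.
exists i, j; split=> //.
have [_ _ _ [a [b hab]]] := consecutive_span hx hij.
have i1 := i2 _ ina; have j1 := i2 _ jna.
have [b0 hb] := coef_bound hx (i := i) (j := j) (a := a) (b := b) (introT andP (conj i1 lij)) hab.
have Ai := A1 _ ina; have Ai1 := A1 _ (leqW ina); have Aj := A1 _ jna.
have Aj1 := A1 _ (leqW jna).
have [E hE] : exists E : {set 'I_d.+1 * 'I_d.+1},
  [/\ E != finset.set0, E \subset Tset d
    & eval_int (PE d E) (x i) (a *: x i + b *: x i.+1) = 0].
  apply: (hpair (x i) (x i.+1) a b (A i) (A i.+1) (A j) (A j.+1) b0).
  - rewrite ler_pdivrMr // expRB !(expR_ht hx) //.
    rewrite ler_pdivrMr; last first.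
      by apply: lt_le_trans (minimal_ht_ge1 hx (i := i.+1) isT).
    by apply: le_trans hb _; rewrite (mulrC 3).
  - have hts := hnc _ _ inc hij; have htp := hnc _ _ hnc' hhi.
    rewrite -/(A i) -/(A h.+1) -/(A i.+1) in htp.
    rewrite -/(A j) -/(A i.+1) -/(A j.+1) in hts.
    have Bj : A i.+1 <= A j by apply: (lnht_le hx); rewrite lij.
    have AB : A i <= A i.+1 by apply: (lnht_le hx); rewrite i1 leqnSn.
    have hA0 : 0 < A j by apply: lt_le_trans Aj.
    split=> //.
    + exact: le_trans Ai.
    + exact: le_trans Ai1.
    + apply: le_trans hts _.
      have p := mulr_ge0 (ltW eps0) (le_trans ler01 Ai1).
      have q := mulr_ge0 (ltW eps0) (le_trans ler01 Aj1).
      move: p q; rewrite /eps; clear -h12; lra.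
    + exact: hnb.
    + have hAi : 0 < A i by apply: lt_le_trans Ai.
      have hBh : A h.+1 <= (A i.+1 / A j + eps) * A i.
        by rewrite -ler_pdivrMr //; move: hun; rewrite /u addnS.
      have Bi : A h.+1 <= A i by apply: (lnht_le hx); rewrite lhi.
      have ms : 0 <= 1 - l2 by move: hl2; clear; lra.
      have := ler_wpM2l ms hBh.
      have : eps * A h.+1 <= eps * A i by rewrite ler_wpM2l // ltW.
      have : eps * A i <= eps * A i.+1 by rewrite ler_wpM2l // ltW.
      have : (1 - l2) * (eps * A i) <= 1 * (eps * A i).
        apply: ler_wpM2r; first by rewrite mulr_ge0 // ltW.
        by move: hl1 h12; clear; lra.
      have : 0 <= (l2 - l1) * (A i.+1 / A j * A i).
        rewrite mulr_ge0 ?subr_ge0 ?(ltW h12) //.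
        by rewrite mulr_ge0 ?(ltW hAi) // divr_ge0 ?(ltW hA0) // (le_trans ler01).
      move: htp; rewrite /eps.
      by move: (A i.+1 / A j) => w; clear; lra.
  - by rewrite -hab; exact: hnd.
exists E; rewrite hab; exact: hE.
Qed.

Local Open Scope classical_set_scope.
Local Open Scope ring_scope.

Theorem theorem8p1 (PE : poly_family) (hPE : is_choice_of_P PE)
  (R : realType) (xi : R) (hxi : lin_indep_Q_1_xi_xi3 xi)
  (lambda c : R) (hlambda : 0 < lambda) (hc : 0 < c)
  (hexp : exists X0 : R, forall X : R, X0 <= X ->
     exists x : 'rV[int]_3,
       [/\ x != 0, supnorm (toR R x) <= X
         & Ldist xi (toR R x) <= c * X `^ (- lambda)])
  (x : nat -> 'rV[int]_3) (hx : minimal_points xi x)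
  (hlambda0 : (1 + 3 * Num.sqrt 5) / 11 < lambda) :
  exists (d : nat) (P : Qxy),
    [/\ (0 < d)%N, in_calP PE d P
      & infinite_set [set p : nat * nat |
          consecutive (indexI R x) p.1 p.2
          /\ eval_int P (x p.1) (x p.2) = 0]].
Proof.
pose r5 : R := Num.sqrt 5.
have r5_0 : 0 <= r5 by exact: sqrtr_ge0.
have r5_2 : r5 ^+ 2 = 5 by rewrite sqr_sqrtr.
have r5_lo : 67 / 30 <= r5 by move: r5_2 r5_0; clear; nra.
have r5_hi : r5 < 227 / 100 by move: r5_2 r5_0; clear; nra.
(* The hypothesis weakens as lambda decreases, so lambda may be brought next to
   the critical value; the gap between l1 and l2 absorbs the constants. *)
pose l2 := Num.min lambda (71 / 100).
pose l1 := ((1 + 3 * r5) / 11 + l2) / 2.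
have l2_lambda : l2 <= lambda by rewrite ge_min lexx.
have l2_hi : l2 <= 71 / 100 by rewrite ge_min lexx orbT.
have l0_l2 : (1 + 3 * r5) / 11 < l2.
  by rewrite lt_min hlambda0 /=; move: r5_hi; clear; lra.
have l12 : l1 < l2 by rewrite /l1; move: l0_l2; clear; lra.
have l01 : 3 * r5 < 11 * l1 - 1 by rewrite /l1; move: l0_l2; clear; lra.
have l1_lo : 7 / 10 <= l1 by move: l01 r5_lo; clear; lra.
have l1_root : 0 < 11 * l1 ^+ 2 - 2 * l1 - 4.
  have : (3 * r5) ^+ 2 < (11 * l1 - 1) ^+ 2.
    rewrite ltr_pXn2r ?nnegrE ?mulr_ge0 //.
    by apply: le_trans (ltW l01); rewrite mulr_ge0.
  by rewrite exprMn r5_2; clear; lra.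
have [K [n1 hD]] := dist_log_bound hx hc hlambda l2_lambda hexp.
have [d d0 hvan] := frequent_vanishing hPE hxi hx l12 l1_lo l2_hi l1_root hD.
pose zeros (E : {set 'I_d.+1 * 'I_d.+1}) := [set p : nat * nat |
  consecutive (indexI R x) p.1 p.2 /\ eval_int (PE d E) (x p.1) (x p.2) = 0].
pose good (E : {set 'I_d.+1 * 'I_d.+1}) :=
  (E != finset.set0) && (E \subset Tset d).
have [[E [/andP[E0 sE] hinf]]|hfin] :=
  boolp.EM (exists E, good E /\ infinite_set (zeros E)).
  by exists d, (PE d E); split=> //; exists E.
exfalso.
have bounded E : exists m, good E -> forall p, zeros E p -> (p.1 < m)%N.
  have [gE|/negP nE] := boolP (good E); last by exists 0%N.
  have [|m hm] := @finite_pairs_bounded (zeros E); last by exists m.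
  by apply: boolp.contrapT => hE; apply: hfin; exists E.
have [m hm] := fin_all_exists bounded.
have [i [j [Ni hij [E [E0 sE hE]]]]] := hvan (\sum_E m E)%N.
have := hm E (introT andP (conj E0 sE)) (i, j) (conj hij hE).
by rewrite ltnNge (leq_trans _ Ni) // (bigD1 E) //= leq_addr.
Qed.
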